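(* Let $k=2$. Consider the two-dimensional DDG method with forward Euler time discretization on uniform rectangular meshes described in the context, with approximating DG polynomials $c_h^n(x,y)$ of degree $k$, and with $(\beta_0,\beta_1)$ chosen so that $$\frac18\le\beta_1\le\frac14\quad\text{and}\quad\beta_0\ge1 .$$ If $g_h^n(x,y)\ge0$ for all $(x,y)\in S_{jl}$ and $\bar c_{jl}^{\,n}>0$ (for all $1\le j\le P$, $1\le l\le Q$), then $\bar c_{jl}^{\,n+1}>0$ (for all $j,l$) under the CFL condition $$\mu<\mu_0,$$ where $\mu=\mu_x+\mu_y$, $\mu_x=\Delta t/(\Delta x)^2$, $\mu_y=\Delta t/(\Delta y)^2$, the updated cell average is the quadrature form $$\bar c_{jl}^{\,n+1}=\frac{\mu_x}{\mu}\sum_{\sigma=1}^L\omega^\sigma H_1(y_l^\sigma)+\frac{\mu_y}{\mu}\sum_{\sigma=1}^L\omega^\sigma H_2(x_j^\sigma),$$ and $\mu_0=\min\{\mu_0^x,\mu_0^y\}$ with $$\mu_0^x=\min_{j,l}\min_{1\le\sigma\le L}\left\{\frac{\langle\pm\gamma^x\mp\xi(1\pm\gamma^x)+\xi^2\rangle_j(y_l^\sigma)}{2(1\pm\gamma^x)\left(\alpha_3(\mp\gamma^x)M(x_{j-\frac12},y_l^\sigma)+\alpha_1(\pm\gamma^x)M(x_{j+\frac12},y_l^\sigma)\right)},\ \frac{\langle1-\xi^2\rangle_j(y_l^\sigma)}{2(1-4\beta_1)\left[M(x_{j-\frac12},y_l^\sigma)+M(x_{j+\frac12},y_l^\sigma)\right]}\right\},$$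 $$\mu_0^y=\min_{j,l}\min_{1\le\sigma\le L}\left\{\frac{\langle\pm\gamma^y\mp\eta(1\pm\gamma^y)+\eta^2\rangle_l(x_j^\sigma)}{2(1\pm\gamma^y)\left(\alpha_3(\mp\gamma^y)M(x_j^\sigma,y_{l-\frac12})+\alpha_1(\pm\gamma^y)M(x_j^\sigma,y_{l+\frac12})\right)},\ \frac{\langle1-\eta^2\rangle_l(x_j^\sigma)}{2(1-4\beta_1)\left[M(x_j^\sigma,y_{l-\frac12})+M(x_j^\sigma,y_{l+\frac12})\right]}\right\},$$ the minima being also over both choices of sign (upper signs together, lower signs together).
   Context: **Mesh and space.** $\Omega=[0,L_x]\times[0,L_y]=\bigcup I_{jl}$, $I_{jl}=[x_{j-\frac12},x_{j+\frac12}]\times[y_{l-\frac12},y_{l+\frac12}]$, $1\le j\le P$, $1\le l\le Q$, with $\Delta x=L_x/P$, $\Delta y=L_y/Q$, $x_{j+\frac12}=j\Delta x$, $y_{l+\frac12}=l\Delta y$, and cell centers $(x_j,y_l)$. $V_h=\{v\in L^2(\Omega): v|_{I_{jl}}\in P^k(I_{jl})\}$, with $P^k$ the polynomials of (total) degree at most $k$ ($k=2$ here). Across an interior edge, in the positive $x$ (resp. $y$) direction, $[w]=w^+-w^-$ and $\{w\}=\frac12(w^++w^-)$. The notation $\cdot\,|_{x_{j-1/2}}^{x_{j+1/2}}$ means the value at $x_{j+1/2}^-$ minus that at $x_{j-1/2}^+$ (traces taken from inside the cell), and similarly in $y$. **Scheme.** The equation is $\partial_tc=\partial_x(M\partial_xg)+\partial_y(M\partial_yg)$,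 $c=gM$, $M=e^{-q_i\psi}$, with zero-flux boundary conditions; here $(c,g,M)=(c_i,g_i,M_i)$ for one species $i$ of the Poisson--Nernst--Planck system $\partial_tc_i=\nabla\cdot(\nabla c_i+q_ic_i\nabla\psi)$, $-\Delta\psi=\sum_{i=1}^mq_ic_i+\rho_0$. Given $c_{ih}^n\in V_h$: (1) $\psi_h^n\in V_h$ is obtained from the DDG discretization of the Poisson equation: on each cell $K$ and for all $\eta\in V_h$, $\int_K\nabla\psi_h\cdot\nabla\eta\,dx-\int_{\partial K}(\widehat{\partial_n\psi_h}\,\eta+(\psi_h-\{\psi_h\})\partial_n\eta)\,ds=\int_K(\sum_iq_ic_{ih}+\rho_0)\eta\,dx$, with interior flux $\beta_0'[\psi_h]/h_e+\{\partial_n\psi_h\}+\beta_1'h_e[\partial_n^2\psi_h]$ ($h_e$ is the mesh size in the direction normal to the edge; $\beta_0',\beta_1'$ may be chosen independently of $\beta_0,\beta_1$) and, on the boundary, $\{\psi_h\}=\psi_D$, $\widehat{\partial_n\psi_h}=\frac{\beta_0'}{h_e}(\psi_D-\psi_h)+\partial_{\mathbf n}\psi_h$ on the Dirichlet part and $\{\psi_h\}=\psi_h$, $\widehat{\partial_n\psi_h}=\sigma$ on the Neumann part. Set $M=M_{ih}^n=e^{-q_i\psi_h^n}$. (2) $g_h^n\in V_h$ is defined by $\int_{I_{jl}}g_h^nM_{ih}^nr\,dxdy=\int_{I_{jl}}c_h^nr\,dxdy$ for all $r\in V_h$ and all $j,l$. (3) The update is: for all $v\in V_h$ and all $j,l$,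 $$\int_{I_{jl}}c_h^{n+1}v=\int_{I_{jl}}c_h^nv-\Delta t\int_{I_{jl}}M_{ih}^n\nabla g_h^n\cdot\nabla v+\Delta t\left.\int_{y_{l-\frac12}}^{y_{l+\frac12}}\{M_{ih}^n\}[\widehat{\partial_xg_h^n}v+(g_h^n-\{g_h^n\})\partial_xv]dy\right|_{x_{j-\frac12}}^{x_{j+\frac12}}+\Delta t\left.\int_{x_{j-\frac12}}^{x_{j+\frac12}}\{M_{ih}^n\}[\widehat{\partial_yg_h^n}v+(g_h^n-\{g_h^n\})\partial_yv]dx\right|_{y_{l-\frac12}}^{y_{l+\frac12}},$$ where on interior interfaces $\widehat{\partial_xg_h}=\frac{\beta_0}{\Delta x}[g_h]+\{\partial_xg_h\}+\beta_1\Delta x[\partial_x^2g_h]$ at $x=x_{j+\frac12}$ and $\widehat{\partial_yg_h}=\frac{\beta_0}{\Delta y}[g_h]+\{\partial_yg_h\}+\beta_1\Delta y[\partial_y^2g_h]$ at $y=y_{l+\frac12}$; on $\partial\Omega$ these fluxes are zero and $\{g_h^n\}=g_h^n$. **Cell averages and quadrature.** $\bar c_{jl}^{\,n}=\frac{1}{\Delta x\Delta y}\int_{I_{jl}}c_h^n\,dxdy$. Taking $v=1$ in the scheme, the cell average update is $$\bar c_{jl}^{\,n+1}=\frac{\mu_x}{\mu}\frac1{\Delta y}\int_{y_{l-1/2}}^{y_{l+1/2}}H_1(y)\,dy+\frac{\mu_y}{\mu}\frac1{\Delta x}\int_{x_{j-1/2}}^{x_{j+1/2}}H_2(x)\,dx,$$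 $$H_1(y)=\langle g_h^n\rangle_j(y)+\mu\Delta x\left.\{M_{ih}^n\}\widehat{\partial_xg_h^n}\right|_{x_{j-\frac12}}^{x_{j+\frac12}},\qquad H_2(x)=\langle g_h^n\rangle_l(x)+\mu\Delta y\left.\{M_{ih}^n\}\widehat{\partial_yg_h^n}\right|_{y_{l-\frac12}}^{y_{l+\frac12}},$$ and the integrals are replaced by an $L$-point Gauss quadrature, $L\ge\frac{k+2}2$, giving the quadrature form of $\bar c_{jl}^{\,n+1}$ in the claim. Here $S_j^x=\{x_j^\sigma\}_{\sigma=1}^L$ and $S_l^y=\{y_l^\sigma\}_{\sigma=1}^L$ are the Gauss points on $[x_{j-\frac12},x_{j+\frac12}]$ and $[y_{l-\frac12},y_{l+\frac12}]$, and $\omega^\sigma$ are the Gauss weights normalized by $\sum_\sigma\omega^\sigma=1$. **Weighted averages.** For functions on the cell, $\langle g\rangle_j(y)=\frac1{\Delta x}\int_{x_{j-1/2}}^{x_{j+1/2}}g(x,y)M_{ih}^n(x,y)dx$ and $\langle g\rangle_l(x)=\frac1{\Delta y}\int_{y_{l-1/2}}^{y_{l+1/2}}g(x,y)M_{ih}^n(x,y)dy$. For functions of the reference variables $\xi,\eta\in[-1,1]$, where $x=x_j+\frac{\Delta x}2\xi$ and $y=y_l+\frac{\Delta y}2\eta$, $$\langle\phi(\xi)\rangle_j(y)=\tfrac12\int_{-1}^1\phi(\xi)M(x_j+\tfrac{\Delta x}2\xi,y)d\xi,\qquad \langle\phi(\eta)\rangle_l(x)=\tfrac12\int_{-1}^1\phi(\eta)M(x,y_l+\tfrac{\Delta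 y}2\eta)d\eta,$$ where within the integrals $M$ is taken in the cell $I_{jl}$. On interfaces, $M(x_{j\pm\frac12},y)$ and $M(x,y_{l\pm\frac12})$ denote $\{M_{ih}^n\}$ (the interior trace on $\partial\Omega$). **Test set.** For each cell and each $y=y_l^\sigma$ set $a_j=\frac{\langle\xi-\xi^2\rangle_j(y)}{\langle1-\xi\rangle_j(y)}$, $b_j=\frac{\langle\xi+\xi^2\rangle_j(y)}{\langle1+\xi\rangle_j(y)}$, and choose $\gamma^x$ (depending on $y_l^\sigma$ and the cell) with $a_j<\gamma^x<b_j$, $|\gamma^x|\le8\beta_1-1$. For each $x=x_j^\sigma$ set $a_l=\frac{\langle\eta-\eta^2\rangle_l(x)}{\langle1-\eta\rangle_l(x)}$, $b_l=\frac{\langle\eta+\eta^2\rangle_l(x)}{\langle1+\eta\rangle_l(x)}$, and choose $\gamma^y$ (depending on $x_j^\sigma$ and the cell) with $a_l<\gamma^y<b_l$, $|\gamma^y|\le8\beta_1-1$. Set $\hat S_j^x=x_j+\frac{\Delta x}2\{-1,\gamma^x,1\}$, $\hat S_l^y=y_l+\frac{\Delta y}2\{-1,\gamma^y,1\}$ and $$S_{jl}=(S_j^x\otimes\hat S_l^y)\cup(\hat S_j^x\otimes S_l^y),$$ i.e. the points $(x_j^\sigma,y)$ with $y\in\hat S_l^y$ (using $\gamma^y$ for $x_j^\sigma$) together with the points $(x,y_l^\sigma)$ with $x\in\hat S_j^x$ (using $\gamma^x$ for $y_l^\sigma$), $1\le\sigma\le L$. **Coefficients.** $\alpha_1(\gamma)=\dfrac{8\beta_1-1+\gamma}{2(1+\gamma)}$,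 $\alpha_3(\gamma)=\beta_0+\dfrac{8\beta_1-3+\gamma}{2(1-\gamma)}$. A quotient with positive numerator and zero denominator is interpreted as $+\infty$.
   Formalization: For the lower signs in μ₀^x and μ₀^y the two interface values of M are exchanged (α₃(γ) is paired with M at j+1/2, resp. l+1/2, and α₁(−γ) with M at j−1/2, resp. l−1/2), since the bound as printed does not guarantee positivity. *)

(* Defs.v *)
From Stdlib Require Import Reals List Arith Lra Lia.
From Coquelicot Require Import Coquelicot.
Open Scope R_scope.

Record mesh := Mesh {
  Lx : R; Ly : R; P : nat; Q : nat;
  Lx_pos : 0 < Lx; Ly_pos : 0 < Ly;
  P_pos : (1 <= P)%nat; Q_pos : (1 <= Q)%nat }.

Section Definitions.
Context (T : mesh).

Definition dx : R := Lx T / INR (P T).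
Definition dy : R := Ly T / INR (Q T).

(* [xh i] is x_{i+1/2}: the cell I_{jl} is [xh (j-1), xh j] x [yh (l-1), yh l]. *)
Definition xh (i : nat) : R := INR i * dx.
Definition yh (i : nat) : R := INR i * dy.
Definition xpt (j : nat) (xi : R) : R := (xh (j - 1) + xh j) / 2 + dx / 2 * xi.
Definition ypt (l : nat) (eta : R) : R := (yh (l - 1) + yh l) / 2 + dy / 2 * eta.

Definition is_cell (j l : nat) : Prop :=
  (1 <= j <= P T)%nat /\ (1 <= l <= Q T)%nat.

(* A piecewise smooth function, given by one smooth function on R^2 for each
   cell; its trace on an edge from inside the cell (j,l) is the value of
   [w j l] there. Values for (j,l) not satisfying [is_cell] are irrelevant. *)
Definition pw := nat -> nat -> R -> R -> R.

Definition is_poly2 (k : nat) (f : R -> R -> R) : Prop :=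
  exists a : nat -> nat -> R, forall x y : R,
    f x y = sum_n (fun p => sum_n (fun r => a p r * x ^ p * y ^ r) (k - p)) k.

Definition in_Vh (k : nat) (v : pw) : Prop :=
  forall j l, is_cell j l -> is_poly2 k (v j l).

Definition Dx (w : pw) : pw := fun j l x y => Derive (fun t => w j l t y) x.
Definition Dy (w : pw) : pw := fun j l x y => Derive (fun t => w j l x t) y.
Definition Dxx (w : pw) : pw := fun j l x y => Derive_n (fun t => w j l t y) 2 x.
Definition Dyy (w : pw) : pw := fun j l x y => Derive_n (fun t => w j l x t) 2 y.

Definition int_x (j : nat) (f : R -> R) : R := RInt f (xh (j - 1)) (xh j).
Definition int_y (l : nat) (f : R -> R) : R := RInt f (yh (l - 1)) (yh l).
Definition int_cell (j l : nat) (f : R -> R -> R) : R :=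
  int_y l (fun y => int_x j (fun x => f x y)).

Definition cell_avg (w : pw) (j l : nat) : R := / (dx * dy) * int_cell j l (w j l).

(* The interface x = xh i is interior iff 0 < i < P; it then separates the
   cells (i,l) and (i+1,l). Likewise for y = yh i. *)
Definition jump_x (w : pw) (i l : nat) (y : R) : R :=
  w (S i) l (xh i) y - w i l (xh i) y.
Definition jump_y (w : pw) (j i : nat) (x : R) : R :=
  w j (S i) x (yh i) - w j i x (yh i).
Definition mean_x (w : pw) (i l : nat) (y : R) : R :=
  / 2 * (w (S i) l (xh i) y + w i l (xh i) y).
Definition mean_y (w : pw) (j i : nat) (x : R) : R :=
  / 2 * (w j (S i) x (yh i) + w j i x (yh i)).

(* {w}, with {w} = interior trace on the boundary of the domain *)
Definition avg_x (w : pw) (i l : nat) (y : R) : R :=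
  if (i =? 0)%nat then w 1%nat l (xh i) y
  else if (i =? P T)%nat then w i l (xh i) y
  else mean_x w i l y.
Definition avg_y (w : pw) (j i : nat) (x : R) : R :=
  if (i =? 0)%nat then w j 1%nat x (yh i)
  else if (i =? Q T)%nat then w j i x (yh i)
  else mean_y w j i x.

Definition ddg_x (b0 b1 : R) (w : pw) (i l : nat) (y : R) : R :=
  b0 / dx * jump_x w i l y + mean_x (Dx w) i l y + b1 * dx * jump_x (Dxx w) i l y.
Definition ddg_y (b0 b1 : R) (w : pw) (j i : nat) (x : R) : R :=
  b0 / dy * jump_y w j i x + mean_y (Dy w) j i x + b1 * dy * jump_y (Dyy w) j i x.

Record poisson_data := PoissonData {
  pb0 : R; pb1 : R;                (* beta_0', beta_1' *)
  rho0 : R -> R -> R;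
  on_D : R -> R -> bool;           (* indicator of the Dirichlet part of the boundary *)
  psi_D : R -> R -> R;
  sigma_N : R -> R -> R }.

(* [psi_flux_x] is the flux in the positive x direction. At the left boundary,
   where the outward normal is -e_x, it is therefore minus the normal flux
   pb0 / dx * (psi_D - psi) + d_n psi, resp. minus sigma_N. *)
Definition psi_flux_x (D : poisson_data) (psi : pw) (i l : nat) (y : R) : R :=
  if (i =? 0)%nat then
    if on_D D (xh i) y
    then - (pb0 D / dx * (psi_D D (xh i) y - psi 1%nat l (xh i) y)
            - Dx psi 1%nat l (xh i) y)
    else - sigma_N D (xh i) y
  else if (i =? P T)%nat then
    if on_D D (xh i) y
    then pb0 D / dx * (psi_D D (xh i) y - psi i l (xh i) y) + Dx psi i l (xh i) y
    else sigma_N D (xh i) y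
  else ddg_x (pb0 D) (pb1 D) psi i l y.
Definition psi_flux_y (D : poisson_data) (psi : pw) (j i : nat) (x : R) : R :=
  if (i =? 0)%nat then
    if on_D D x (yh i)
    then - (pb0 D / dy * (psi_D D x (yh i) - psi j 1%nat x (yh i))
            - Dy psi j 1%nat x (yh i))
    else - sigma_N D x (yh i)
  else if (i =? Q T)%nat then
    if on_D D x (yh i)
    then pb0 D / dy * (psi_D D x (yh i) - psi j i x (yh i)) + Dy psi j i x (yh i)
    else sigma_N D x (yh i)
  else ddg_y (pb0 D) (pb1 D) psi j i x.

Definition psi_avg_x (D : poisson_data) (psi : pw) (i l : nat) (y : R) : R :=
  if (((i =? 0)%nat || (i =? P T)%nat) && on_D D (xh i) y)%bool
  then psi_D D (xh i) y else avg_x psi i l y.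
Definition psi_avg_y (D : poisson_data) (psi : pw) (j i : nat) (x : R) : R :=
  if (((i =? 0)%nat || (i =? Q T)%nat) && on_D D x (yh i))%bool
  then psi_D D x (yh i) else avg_y psi j i x.

(* (flux * eta + (psi - {psi}) * d eta) on the interface i, with traces of psi
   and eta from the cell (j,l) *)
Definition psi_edge_x D psi (eta : pw) (j l i : nat) (y : R) : R :=
  psi_flux_x D psi i l y * eta j l (xh i) y
  + (psi j l (xh i) y - psi_avg_x D psi i l y) * Dx eta j l (xh i) y.
Definition psi_edge_y D psi (eta : pw) (j l i : nat) (x : R) : R :=
  psi_flux_y D psi j i x * eta j l x (yh i)
  + (psi j l x (yh i) - psi_avg_y D psi j i x) * Dy eta j l x (yh i).

(* The species are c 1, ..., c m, with charges q 1, ..., q m. *)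
Definition ddg_poisson (k : nat) (D : poisson_data) (m : nat) (q : nat -> R)
    (c : nat -> pw) (psi : pw) : Prop :=
  forall eta : pw, in_Vh k eta -> forall j l, is_cell j l ->
    int_cell j l (fun x y => Dx psi j l x y * Dx eta j l x y
                             + Dy psi j l x y * Dy eta j l x y)
    - (int_y l (fun y => psi_edge_x D psi eta j l j y
                         - psi_edge_x D psi eta j l (j - 1) y)
       + int_x j (fun x => psi_edge_y D psi eta j l l x
                           - psi_edge_y D psi eta j l (l - 1) x))
    = int_cell j l (fun x y =>
        (sum_n_m (fun i => q i * c i j l x y) 1 m + rho0 D x y) * eta j l x y).

Definition weightM (qi : R) (psi : pw) : pw := fun j l x y => exp (- qi * psi j l x y).

Definition is_projection (k : nat) (M c g : pw) : Prop :=
  in_Vh k g /\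
  forall r : pw, in_Vh k r -> forall j l, is_cell j l ->
    int_cell j l (fun x y => g j l x y * M j l x y * r j l x y)
    = int_cell j l (fun x y => c j l x y * r j l x y).

Definition flux_x (b0 b1 : R) (g : pw) (i l : nat) (y : R) : R :=
  if ((i =? 0)%nat || (i =? P T)%nat)%bool then 0 else ddg_x b0 b1 g i l y.
Definition flux_y (b0 b1 : R) (g : pw) (j i : nat) (x : R) : R :=
  if ((i =? 0)%nat || (i =? Q T)%nat)%bool then 0 else ddg_y b0 b1 g j i x.

Definition edge_x b0 b1 (M g v : pw) (j l i : nat) (y : R) : R :=
  avg_x M i l y * (flux_x b0 b1 g i l y * v j l (xh i) y
                   + (g j l (xh i) y - avg_x g i l y) * Dx v j l (xh i) y).
Definition edge_y b0 b1 (M g v : pw) (j l i : nat) (x : R) : R :=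
  avg_y M j i x * (flux_y b0 b1 g j i x * v j l x (yh i)
                   + (g j l x (yh i) - avg_y g j i x) * Dy v j l x (yh i)).

(* The forward Euler step with exact integrals, from c to c' *)
Definition euler_step (k : nat) (b0 b1 dt : R) (M g c c' : pw) : Prop :=
  forall v : pw, in_Vh k v -> forall j l, is_cell j l ->
    int_cell j l (fun x y => c' j l x y * v j l x y)
    = int_cell j l (fun x y => c j l x y * v j l x y)
      - dt * int_cell j l (fun x y =>
               M j l x y * (Dx g j l x y * Dx v j l x y + Dy g j l x y * Dy v j l x y))
      + dt * int_y l (fun y => edge_x b0 b1 M g v j l j y
                               - edge_x b0 b1 M g v j l (j - 1) y)
      + dt * int_x j (fun x => edge_y b0 b1 M g v j l l x
                               - edge_y b0 b1 M g v j l (l - 1) x).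

Definition mu_x (dt : R) : R := dt / dx ^ 2.
Definition mu_y (dt : R) : R := dt / dy ^ 2.
Definition mu (dt : R) : R := mu_x dt + mu_y dt.

Definition H1 (b0 b1 dt : R) (M g : pw) (j l : nat) (y : R) : R :=
  / dx * int_x j (fun x => g j l x y * M j l x y)
  + mu dt * dx * (avg_x M j l y * flux_x b0 b1 g j l y
                  - avg_x M (j - 1) l y * flux_x b0 b1 g (j - 1) l y).
Definition H2 (b0 b1 dt : R) (M g : pw) (j l : nat) (x : R) : R :=
  / dy * int_y l (fun y => g j l x y * M j l x y)
  + mu dt * dy * (avg_y M j l x * flux_y b0 b1 g j l x
                  - avg_y M j (l - 1) x * flux_y b0 b1 g j (l - 1) x).

(* The cell average update, with [meany] and [meanx] computing the mean values
   over the y and x sides of the cell, exactly or by quadrature *)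
Definition average_update (meanx meany : nat -> (R -> R) -> R)
    (b0 b1 dt : R) (M g : pw) (j l : nat) : R :=
  mu_x dt / mu dt * meany l (H1 b0 b1 dt M g j l)
  + mu_y dt / mu dt * meanx j (H2 b0 b1 dt M g j l).

Definition exact_x (j : nat) (f : R -> R) : R := / dx * int_x j f.
Definition exact_y (l : nat) (f : R -> R) : R := / dy * int_y l f.

(* n nodes s 1 < ... < s n in [-1,1] and weights w 1, ..., w n (summing to 1),
   exact for the mean value of every polynomial of degree at most 2n-1 *)
Definition gauss_rule (n : nat) (s w : nat -> R) : Prop :=
  (forall i, (1 <= i <= n)%nat -> -1 <= s i <= 1) /\
  (forall i i', (1 <= i)%nat -> (i < i')%nat -> (i' <= n)%nat -> s i < s i') /\
  (forall a : nat -> R,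
     sum_n_m (fun i => w i * sum_n (fun p => a p * s i ^ p) (2 * n - 1)) 1 n
     = / 2 * RInt (fun t => sum_n (fun p => a p * t ^ p) (2 * n - 1)) (-1) 1).

Definition gauss_x (n : nat) (s w : nat -> R) (j : nat) (f : R -> R) : R :=
  sum_n_m (fun i => w i * f (xpt j (s i))) 1 n.
Definition gauss_y (n : nat) (s w : nat -> R) (l : nat) (f : R -> R) : R :=
  sum_n_m (fun i => w i * f (ypt l (s i))) 1 n.

Definition wavg_x (M : pw) (phi : R -> R) (j l : nat) (y : R) : R :=
  / 2 * RInt (fun xi => phi xi * M j l (xpt j xi) y) (-1) 1.
Definition wavg_y (M : pw) (phi : R -> R) (j l : nat) (x : R) : R :=
  / 2 * RInt (fun eta => phi eta * M j l x (ypt l eta)) (-1) 1.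

Definition a_x (M : pw) j l y : R :=
  wavg_x M (fun xi => xi - xi ^ 2) j l y / wavg_x M (fun xi => 1 - xi) j l y.
Definition b_x (M : pw) j l y : R :=
  wavg_x M (fun xi => xi + xi ^ 2) j l y / wavg_x M (fun xi => 1 + xi) j l y.
Definition a_y (M : pw) j l x : R :=
  wavg_y M (fun eta => eta - eta ^ 2) j l x / wavg_y M (fun eta => 1 - eta) j l x.
Definition b_y (M : pw) j l x : R :=
  wavg_y M (fun eta => eta + eta ^ 2) j l x / wavg_y M (fun eta => 1 + eta) j l x.

(* [gx j l i] is the gamma^x chosen for the cell (j,l) and the i-th Gauss point
   in y; [gy j l i] is the gamma^y for the i-th Gauss point in x. *)
Definition gamma_choice_x (n : nat) (s : nat -> R) (b1 : R) (M : pw)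
    (gx : nat -> nat -> nat -> R) : Prop :=
  forall j l i, is_cell j l -> (1 <= i <= n)%nat ->
    a_x M j l (ypt l (s i)) < gx j l i < b_x M j l (ypt l (s i)) /\
    Rabs (gx j l i) <= 8 * b1 - 1.
Definition gamma_choice_y (n : nat) (s : nat -> R) (b1 : R) (M : pw)
    (gy : nat -> nat -> nat -> R) : Prop :=
  forall j l i, is_cell j l -> (1 <= i <= n)%nat ->
    a_y M j l (xpt j (s i)) < gy j l i < b_y M j l (xpt j (s i)) /\
    Rabs (gy j l i) <= 8 * b1 - 1.

Definition in_test_set (n : nat) (s : nat -> R) (gx gy : nat -> nat -> nat -> R)
    (j l : nat) (x y : R) : Prop :=
  exists i, (1 <= i <= n)%nat /\
    ((x = xpt j (s i) /\
      exists t, In t (-1 :: gy j l i :: 1 :: nil) /\ y = ypt l t) \/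
     (y = ypt l (s i) /\
      exists t, In t (-1 :: gx j l i :: 1 :: nil) /\ x = xpt j t)).

Definition alpha1 (b1 g : R) : R := (8 * b1 - 1 + g) / (2 * (1 + g)).
Definition alpha3 (b0 b1 g : R) : R := b0 + (8 * b1 - 3 + g) / (2 * (1 - g)).

Definition quot (n d : R) : Rbar :=
  if Req_dec_T d 0 then p_infty else Finite (n / d).

Definition Rbar_min_over (n : nat) (f : nat -> Rbar) : Rbar :=
  fold_right Rbar_min p_infty (map f (seq 1 n)).

(* The ratio bounding the weight of the endpoint at xi = -e, for e = 1 (upper
   signs) or e = -1 (lower signs) and g = gamma. [Mnear] is the value of M on
   the interface at that endpoint, [Mfar] on the opposite one: in the numerical
   flux through its own interface an endpoint value has coefficient
   alpha3 (- e * g), in the flux through the opposite one alpha1 (e * g). Hence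
   M(x_{j-1/2}) and M(x_{j+1/2}) are exchanged for the lower signs, i.e. the
   denominator is 2(1 +- g)(alpha3(-+ g) M(x_{j -+ 1/2}) + alpha1(+- g) M(x_{j +- 1/2})).
   With alpha3 paired with M(x_{j-1/2}) for both signs, the bound would not
   ensure positivity of the averages. *)
Definition endpoint_ratio (wavg : (R -> R) -> R) (b0 b1 g e Mnear Mfar : R) : Rbar :=
  quot (wavg (fun t => e * g - e * t * (1 + e * g) + t ^ 2))
       (2 * (1 + e * g)
        * (alpha3 b0 b1 (- (e * g)) * Mnear + alpha1 b1 (e * g) * Mfar)).

Definition middle_ratio (wavg : (R -> R) -> R) (b1 Ml Mr : R) : Rbar :=
  quot (wavg (fun t => 1 - t ^ 2)) (2 * (1 - 4 * b1) * (Ml + Mr)).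

Definition cfl_ratio (wavg : (R -> R) -> R) (b0 b1 g Ml Mr : R) : Rbar :=
  Rbar_min (Rbar_min (endpoint_ratio wavg b0 b1 g 1 Ml Mr)
                     (endpoint_ratio wavg b0 b1 g (-1) Mr Ml))
           (middle_ratio wavg b1 Ml Mr).

Definition mu0_x (n : nat) (s : nat -> R) (b0 b1 : R) (M : pw)
    (gx : nat -> nat -> nat -> R) : Rbar :=
  Rbar_min_over (P T) (fun j => Rbar_min_over (Q T) (fun l =>
    Rbar_min_over n (fun i =>
      let y := ypt l (s i) in
      cfl_ratio (fun phi => wavg_x M phi j l y) b0 b1 (gx j l i)
                (avg_x M (j - 1) l y) (avg_x M j l y)))).
Definition mu0_y (n : nat) (s : nat -> R) (b0 b1 : R) (M : pw)
    (gy : nat -> nat -> nat -> R) : Rbar :=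
  Rbar_min_over (P T) (fun j => Rbar_min_over (Q T) (fun l =>
    Rbar_min_over n (fun i =>
      let x := xpt j (s i) in
      cfl_ratio (fun phi => wavg_y M phi j l x) b0 b1 (gy j l i)
                (avg_y M j (l - 1) x) (avg_y M j l x)))).

Definition mu0 n s b0 b1 M gx gy : Rbar :=
  Rbar_min (mu0_x n s b0 b1 M gx) (mu0_y n s b0 b1 M gy).

End Definitions.

Inductive smooth2 : (R -> R -> R) -> Prop :=
| sm_cst a : smooth2 (fun _ _ => a)
| sm_fst : smooth2 (fun x _ => x)
| sm_snd : smooth2 (fun _ y => y)
| sm_add f g : smooth2 f -> smooth2 g -> smooth2 (fun x y => f x y + g x y)
| sm_mul f g : smooth2 f -> smooth2 g -> smooth2 (fun x y => f x y * g x y)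
| sm_exp f : smooth2 f -> smooth2 (fun x y => exp (f x y))
| sm_ext f g : (forall x y, f x y = g x y) -> smooth2 f -> smooth2 g.

Lemma sm_sub f g : smooth2 f -> smooth2 g -> smooth2 (fun x y => f x y - g x y).
Proof.
intros Hf Hg.
apply sm_ext with (fun x y => f x y + (-1) * g x y); [intros; ring|].
apply sm_add; [easy|]; apply sm_mul; [apply sm_cst|easy].
Qed.

Lemma sm_swap f : smooth2 f -> smooth2 (fun x y => f y x).
Proof.
induction 1; try (now constructor).
now apply sm_ext with (fun x y => f y x).
Qed.

Lemma sm_derive f : smooth2 f ->
  exists f', smooth2 f' /\ forall x y, is_derive (fun t => f t y) x (f' x y).
Proof.
induction 1 as [a| | |f g Hf [f' [Sf Df]] Hg [g' [Sg Dg]]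
  |f g Hf [f' [Sf Df]] Hg [g' [Sg Dg]]|f Hf [f' [Sf Df]]|f g E Hf [f' [Sf Df]]].
- exists (fun _ _ => 0); split; [constructor|intros; auto_derive; auto].
- exists (fun _ _ => 1); split; [constructor|intros; auto_derive; auto].
- exists (fun _ _ => 0); split; [constructor|intros; auto_derive; auto].
- exists (fun x y => f' x y + g' x y); split; [now constructor|intros].
  now apply (is_derive_plus (fun t => f t y) (fun t => g t y) x).
- exists (fun x y => f' x y * g x y + f x y * g' x y); split.
  + apply sm_add; now apply sm_mul.
  + intros x y. apply (is_derive_mult (fun t => f t y) (fun t => g t y) x);
      auto; intros; apply Rmult_comm.
- exists (fun x y => f' x y * exp (f x y)); split.
  + apply sm_mul; [easy|now apply sm_exp].
  + intros x y. apply (is_derive_comp exp (fun t => f t y)); [apply is_derive_exp|easy].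
- exists f'; split; [easy|intros].
  apply is_derive_ext with (fun t => f t y); auto.
Qed.

Lemma sm_continuity f : smooth2 f -> forall x y, continuity_2d_pt f x y.
Proof.
induction 1; intros x y.
- apply continuity_2d_pt_const.
- apply continuity_2d_pt_id1.
- apply continuity_2d_pt_id2.
- now apply continuity_2d_pt_plus.
- now apply continuity_2d_pt_mult.
- apply (continuity_1d_2d_pt_comp exp f); [|easy].
  apply derivable_continuous_pt, derivable_pt_exp.
- apply continuity_2d_pt_ext with f; auto.
Qed.

Lemma sm_continuous f : smooth2 f -> forall x y, continuous (fun t => f t y) x.
Proof.
intros Hf x y; destruct (sm_derive f Hf) as [f' [_ D]].
apply (ex_derive_continuous (fun t => f t y)); now exists (f' x y).
Qed.

Lemma sm_ex_RInt f a b y : smooth2 f -> ex_RInt (fun x => f x y) a b.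
Proof.
intros Hf; apply @ex_RInt_continuous; intros; now apply (sm_continuous f).
Qed.

Lemma sm_is_derive_RInt f a b y : smooth2 f ->
  exists d, is_derive (fun y => RInt (fun x => f x y) a b) y d.
Proof.
intros Hf.
destruct (sm_derive _ (sm_swap f Hf)) as [f' [Sf D]]; cbn in D.
eexists; apply (is_derive_RInt_param (fun y x => f x y)).
- apply filter_forall; intros z t _; now exists (f' z t).
- intros t _; apply continuity_2d_pt_ext with f'; [|now apply sm_continuity].
  intros u v; symmetry; apply is_derive_unique, D.
- apply filter_forall; intros; now apply sm_ex_RInt.
Qed.

Lemma sm_continuous_RInt f a b y : smooth2 f ->
  continuous (fun y => RInt (fun x => f x y) a b) y.
Proof.
intros Hf; destruct (sm_is_derive_RInt f a b y Hf) as [d D].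
apply (ex_derive_continuous (fun y => RInt (fun x => f x y) a b)); now exists d.
Qed.

Lemma sm_Fubini f a b c d : smooth2 f ->
  RInt (fun y => RInt (fun x => f x y) a b) c d
  = RInt (fun x => RInt (fun y => f x y) c d) a b.
Proof.
intros Hf.
assert (D : forall t x, is_derive (fun z => RInt (fun y => f x y) c z) t (f x t)).
{ intros t x; apply is_derive_RInt with (a := c).
  - apply filter_forall; intros z; apply @RInt_correct.
    exact (sm_ex_RInt _ _ _ _ (sm_swap f Hf)).
  - exact (sm_continuous _ (sm_swap f Hf) t x). }
assert (H : forall t, is_derive (fun t => RInt (fun x => RInt (fun y => f x y) c t) a b)
   t (RInt (fun x => f x t) a b)).
{ intros t.
  replace (RInt (fun x => f x t) a b)
    with (RInt (fun x => Derive (fun z => RInt (fun y => f x y) c z) t) a b)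
    by (apply RInt_ext; intros; apply is_derive_unique, D).
  apply (is_derive_RInt_param (fun z x => RInt (fun y => f x y) c z)).
  - apply filter_forall; intros z x _; now exists (f x z).
  - intros x _; apply continuity_2d_pt_ext with (fun u v => f v u).
    + intros u v; symmetry; apply is_derive_unique, D.
    + apply sm_continuity, sm_swap, Hf.
  - apply filter_forall; intros z; apply @ex_RInt_continuous; intros x _.
    apply (sm_continuous_RInt (fun y x => f x y)), (sm_swap _ Hf). }
replace (RInt (fun x => RInt (fun y => f x y) c d) a b)
  with (minus (RInt (fun x => RInt (fun y => f x y) c d) a b)
              (RInt (fun x => RInt (fun y => f x y) c c) a b)).
- apply is_RInt_unique.
  apply (is_RInt_derive (fun t => RInt (fun x => RInt (fun y => f x y) c t) a b)).
  + intros; apply H.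
  + intros; now apply sm_continuous_RInt.
- replace (RInt (fun x => RInt (fun y => f x y) c c) a b) with 0.
  + unfold minus, plus, opp; cbn; ring.
  + rewrite (RInt_ext _ (fun _ => 0)) by (intros; apply @RInt_point).
    rewrite RInt_const; unfold scal; cbn; unfold mult; cbn; ring.
Qed.

Lemma sm_poly k f : is_poly2 k f -> smooth2 f.
Proof.
intros [a E].
apply sm_ext with (fun x y =>
  sum_n (fun p => sum_n (fun r => a p r * x ^ p * y ^ r) (k - p)) k).
{ intros; now rewrite E. }
assert (S : forall n (h : nat -> R -> R -> R), (forall i, smooth2 (h i)) ->
  smooth2 (fun x y => sum_n (fun i => h i x y) n)).
{ intros n h Hh; induction n as [|n IH].
  - apply sm_ext with (h O); [intros; now rewrite sum_O|easy].
  - apply sm_ext with (fun x y => sum_n (fun i => h i x y) n + h (S n) x y).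
    + intros; now rewrite sum_Sn.
    + now apply sm_add. }
assert (X : forall n, smooth2 (fun x _ => x ^ n)).
{ induction n as [|n IH]; [exact (sm_cst 1)|exact (sm_mul _ _ sm_fst IH)]. }
apply S; intros p; apply (S _ (fun r x y => a p r * x ^ p * y ^ r)); intros r.
apply sm_mul; [apply sm_mul; [apply sm_cst|apply X]|apply (sm_swap _ (X r))].
Qed.

Lemma sm_Derive f : smooth2 f -> smooth2 (fun x y => Derive (fun t => f t y) x).
Proof.
intros Hf; destruct (sm_derive f Hf) as [f' [S D]].
apply sm_ext with f'; [intros; symmetry; apply is_derive_unique, D|easy].
Qed.

Lemma sm_Derive2 f : smooth2 f -> smooth2 (fun x y => Derive_n (fun t => f t y) 2 x).
Proof. intros Hf; exact (sm_Derive _ (sm_Derive _ Hf)). Qed.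

(* Functions of one variable, seen as functions of the first of two *)
Definition smooth1 (h : R -> R) : Prop := smooth2 (fun x _ => h x).

Lemma sm_freeze_fst f x : smooth2 f -> smooth1 (f x).
Proof.
unfold smooth1; induction 1; try (now constructor).
now apply sm_ext with (fun y _ => f x y).
Qed.

Lemma sm_freeze_snd f y : smooth2 f -> smooth1 (fun x => f x y).
Proof. intros Hf; exact (sm_freeze_fst _ y (sm_swap _ Hf)). Qed.

Lemma sm1_ex_RInt h a b : smooth1 h -> ex_RInt h a b.
Proof. intros Hh; exact (sm_ex_RInt _ a b 0 Hh). Qed.

Lemma RInt_lin_R (h f : R -> R) (a b r1 r2 : R) : ex_RInt h a b -> ex_RInt f a b ->
  RInt (fun x => r1 * h x + r2 * f x) a b = r1 * RInt h a b + r2 * RInt f a b.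
Proof.
intros Eh Ef.
replace (r1 * RInt h a b) with (RInt (fun x => r1 * h x) a b)
  by exact (RInt_scal (V := R_CompleteNormedModule) h a b r1 Eh).
replace (r2 * RInt f a b) with (RInt (fun x => r2 * f x) a b)
  by exact (RInt_scal (V := R_CompleteNormedModule) f a b r2 Ef).
apply (RInt_plus (V := R_CompleteNormedModule) (fun x => r1 * h x) (fun x => r2 * f x)).
- exact (ex_RInt_scal (V := R_NormedModule) h a b r1 Eh).
- exact (ex_RInt_scal (V := R_NormedModule) f a b r2 Ef).
Qed.

Section Average.
Context (T : mesh).

Definition smooth_pw (w : pw) : Prop := forall j l, is_cell T j l -> smooth2 (w j l).

Lemma smooth_edge_x b0 b1 M g i l : smooth_pw M -> smooth_pw g ->
  (i <= P T)%nat -> (1 <= l <= Q T)%nat ->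
  smooth1 (fun y => avg_x T M i l y * flux_x T b0 b1 g i l y).
Proof.
intros SM Sg Hi Hl; unfold avg_x, flux_x.
destruct (Nat.eqb_spec i 0) as [|i0]; cbn [orb].
{ apply sm_ext with (fun _ _ => 0); [intros; ring|apply sm_cst]. }
destruct (Nat.eqb_spec i (P T)) as [|iP]; cbn [orb].
{ apply sm_ext with (fun _ _ => 0); [intros; ring|apply sm_cst]. }
assert (C1 : is_cell T i l) by (split; lia).
assert (C2 : is_cell T (S i) l) by (split; lia).
pose proof (Sg _ _ C1) as S1; pose proof (Sg _ _ C2) as S2.
pose proof (SM _ _ C1) as M1; pose proof (SM _ _ C2) as M2.
pose proof (fun f => sm_freeze_fst f (xh T i)) as F.
unfold mean_x, ddg_x, jump_x, mean_x, Dx, Dxx, smooth1.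
repeat first [apply sm_sub | apply sm_mul | apply sm_add | apply sm_cst].
all: try exact (F _ M1); try exact (F _ M2); try exact (F _ S1); try exact (F _ S2).
all: try exact (F _ (sm_Derive _ S1)); try exact (F _ (sm_Derive _ S2)).
all: first [exact (F _ (sm_Derive2 _ S1)) | exact (F _ (sm_Derive2 _ S2))].
Qed.

Lemma smooth_edge_y b0 b1 M g j i : smooth_pw M -> smooth_pw g ->
  (i <= Q T)%nat -> (1 <= j <= P T)%nat ->
  smooth1 (fun x => avg_y T M j i x * flux_y T b0 b1 g j i x).
Proof.
intros SM Sg Hi Hj; unfold avg_y, flux_y.
destruct (Nat.eqb_spec i 0) as [|i0]; cbn [orb].
{ apply sm_ext with (fun _ _ => 0); [intros; ring|apply sm_cst]. }
destruct (Nat.eqb_spec i (Q T)) as [|iQ]; cbn [orb].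
{ apply sm_ext with (fun _ _ => 0); [intros; ring|apply sm_cst]. }
assert (C1 : is_cell T j i) by (split; lia).
assert (C2 : is_cell T j (S i)) by (split; lia).
pose proof (sm_swap _ (Sg _ _ C1)) as S1; pose proof (sm_swap _ (Sg _ _ C2)) as S2.
pose proof (sm_swap _ (SM _ _ C1)) as M1; pose proof (sm_swap _ (SM _ _ C2)) as M2.
pose proof (fun f => sm_freeze_fst f (yh T i)) as F.
unfold mean_y, ddg_y, jump_y, mean_y, Dy, Dyy, smooth1.
repeat first [apply sm_sub | apply sm_mul | apply sm_add | apply sm_cst].
all: try exact (F _ M1); try exact (F _ M2); try exact (F _ S1); try exact (F _ S2).
all: try exact (F _ (sm_Derive _ S1)); try exact (F _ (sm_Derive _ S2)).
all: first [exact (F _ (sm_Derive2 _ S1)) | exact (F _ (sm_Derive2 _ S2))].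
Qed.

Lemma in_Vh_one k : in_Vh T k (fun _ _ _ _ => 1).
Proof.
intros j l _; exists (fun p r => match p, r with O, O => 1 | _, _ => 0 end).
intros x y; rewrite (sum_n_ext _ (fun p => if (p =? 0)%nat then 1 else 0)).
- induction k as [|k IH]; [now rewrite sum_O|].
  rewrite sum_Sn, <- IH; unfold plus; cbn; ring.
- intros [|p]; cbn [Nat.eqb].
  + induction (k - 0)%nat as [|n IH]; [rewrite sum_O; cbn; ring|].
    rewrite sum_Sn, IH; unfold plus; cbn; ring.
  + induction (k - S p)%nat as [|n IH]; [rewrite sum_O; cbn; ring|].
    rewrite sum_Sn, IH; unfold plus; cbn; ring.
Qed.

Lemma int_cell_ext j l f h : (forall x y, f x y = h x y) ->
  int_cell T j l f = int_cell T j l h.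
Proof.
intros E; apply RInt_ext; intros y _; apply RInt_ext; intros x _; apply E.
Qed.

(* Taking v = 1 in [euler_step] gives [average_update] with exact mean values;
   the quadrature form of the cell average replaces these by Gauss rules. *)
Theorem euler_step_average (k : nat) (b0 b1 dt qi : R) (psi M c g c' : pw)
    (dt_pos : 0 < dt) (psi_Vh : in_Vh T k psi) (M_def : M = weightM qi psi)
    (g_def : is_projection T k M c g) (step : euler_step T k b0 b1 dt M g c c') :
  forall j l, is_cell T j l ->
    cell_avg T c' j l
    = average_update T (exact_x T) (exact_y T) b0 b1 dt M g j l.
Proof.
intros j l C.
destruct g_def as [g_Vh g_def].
assert (Sg : smooth_pw g) by (intros j' l' C'; apply (sm_poly k), g_Vh, C').
assert (SM : smooth_pw M).
{ intros j' l' C'; rewrite M_def; unfold weightM; apply sm_exp, sm_mul.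
  - apply sm_cst.
  - apply (sm_poly k), psi_Vh, C'. }
assert (Pd : 0 < dx T /\ 0 < dy T).
{ pose proof (Lx_pos T); pose proof (Ly_pos T); pose proof (P_pos T); pose proof (Q_pos T).
  split; apply Rdiv_lt_0_compat; trivial; apply lt_0_INR; lia. }
destruct Pd as [dx0 dy0].
pose proof (step _ (in_Vh_one k) j l C) as E.
pose proof (g_def _ (in_Vh_one k) j l C) as Eg; cbn beta in E, Eg.
set (gM := fun x y => g j l x y * M j l x y).
assert (SgM : smooth2 gM) by (apply sm_mul; [apply Sg, C|apply SM, C]).
set (Fx := fun i y => avg_x T M i l y * flux_x T b0 b1 g i l y).
set (Fy := fun i x => avg_y T M j i x * flux_y T b0 b1 g j i x).
assert (SFx : smooth1 (fun y => Fx j y - Fx (j - 1)%nat y)).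
{ destruct C as [? ?]; apply sm_sub; apply smooth_edge_x; trivial; lia. }
assert (SFy : smooth1 (fun x => Fy l x - Fy (l - 1)%nat x)).
{ destruct C as [? ?]; apply sm_sub; apply smooth_edge_y; trivial; lia. }
assert (D1 : forall x, Derive (fun _ : R => 1) x = 0) by (intros; apply Derive_const).
rewrite (int_cell_ext j l (fun x y => c' j l x y * 1) (c' j l)) in E by (intros; ring).
rewrite (int_cell_ext j l (fun x y => c j l x y * 1) (c j l)) in E, Eg by (intros; ring).
rewrite (int_cell_ext j l (fun x y => g j l x y * M j l x y * 1) gM) in Eg by (intros; unfold gM; ring).
rewrite <- Eg in E.
rewrite (int_cell_ext j l
  (fun x y => M j l x y * (Dx g j l x y * Dx (fun _ _ _ _ => 1) j l x y
                           + Dy g j l x y * Dy (fun _ _ _ _ => 1) j l x y))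
  (fun _ _ => 0)) in E
  by (intros; unfold Dx, Dy; rewrite !D1; ring).
replace (int_cell T j l (fun _ _ => 0)) with 0 in E.
2:{ unfold int_cell, int_y; symmetry; rewrite (RInt_ext _ (fun _ => 0)).
    - rewrite RInt_const; unfold scal; cbn; unfold mult; cbn; apply Rmult_0_r.
    - intros y _; unfold int_x; rewrite RInt_const; unfold scal; cbn; unfold mult; cbn; apply Rmult_0_r. }
assert (Ex : int_y T l (fun y => edge_x T b0 b1 M g (fun _ _ _ _ => 1) j l j y
   - edge_x T b0 b1 M g (fun _ _ _ _ => 1) j l (j - 1) y)
   = int_y T l (fun y => Fx j y - Fx (j - 1)%nat y)).
{ apply RInt_ext; intros; unfold edge_x, Fx, Dx; rewrite !D1;
  match goal with |- @eq _ ?a ?b => change (@eq R a b) end; ring. }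
assert (Ey : int_x T j (fun x => edge_y T b0 b1 M g (fun _ _ _ _ => 1) j l l x
   - edge_y T b0 b1 M g (fun _ _ _ _ => 1) j l (l - 1) x)
   = int_x T j (fun x => Fy l x - Fy (l - 1)%nat x)).
{ apply RInt_ext; intros; unfold edge_y, Fy, Dy; rewrite !D1;
  match goal with |- @eq _ ?a ?b => change (@eq R a b) end; ring. }
rewrite Ex, Ey in E; clear Ex Ey.
unfold cell_avg; rewrite E; unfold average_update, exact_x, exact_y, H1, H2.
fold gM.
assert (I1 : int_y T l (fun y => / dx T * int_x T j (fun x => g j l x y * M j l x y)
     + mu T dt * dx T * (Fx j y - Fx (j - 1)%nat y))
  = / dx T * int_cell T j l gM
    + mu T dt * dx T * int_y T l (fun y => Fx j y - Fx (j - 1)%nat y)).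
{ assert (X : ex_RInt (fun y => int_x T j (fun x => gM x y)) (yh T (l - 1)) (yh T l)).
  { apply @ex_RInt_continuous; intros y _; now apply sm_continuous_RInt. }
  unfold int_y at 1; rewrite RInt_lin_R; [reflexivity|exact X|now apply sm1_ex_RInt]. }
assert (I2 : int_x T j (fun x => / dy T * int_y T l (fun y => g j l x y * M j l x y)
     + mu T dt * dy T * (Fy l x - Fy (l - 1)%nat x))
  = / dy T * int_cell T j l gM
    + mu T dt * dy T * int_x T j (fun x => Fy l x - Fy (l - 1)%nat x)).
{ assert (X : ex_RInt (fun x => int_y T l (fun y => gM x y)) (xh T (j - 1)) (xh T j)).
  { apply @ex_RInt_continuous; intros x _.
    now apply (sm_continuous_RInt (fun y x => gM x y)), (sm_swap gM). }
  unfold int_cell; unfold int_y at 2; unfold int_x at 2; rewrite sm_Fubini by easy.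
  unfold int_x at 1; rewrite RInt_lin_R; [reflexivity|exact X|now apply sm1_ex_RInt]. }
unfold Fx in I1 at 1 2; unfold Fy in I2 at 1 2.
rewrite I1, I2; unfold mu, mu_x, mu_y; field.
assert (0 < dx T ^ 2) by now apply pow_lt.
assert (0 < dy T ^ 2) by now apply pow_lt.
repeat split; nra.
Qed.

End Average.

(* Main.v *)
Require Import Defs.
From Stdlib Require Import Reals List Lra Lia.
From Coquelicot Require Import Coquelicot.
Open Scope R_scope.

(** Why the average stays positive. On a horizontal line through a cell, [g] is a
quadratic in the reference variable, hence determined by its values at the
nodes -1, gamma, 1. Rewriting everything in these nodal values:

- the weighted average of [g] is a combination of the three values whose
  coefficients are positive, because a < gamma < b ([row_average],
  [gam_interior]);
- the numerical flux through an interface is a nonnegative combination of the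
  three values of the right cell minus a nonnegative combination of those of the
  left cell ([interior_flux], [out_nonneg]). This is where the conditions on
  beta0, beta1 and |gamma| enter.

A neighbouring cell thus only adds to [H1], and the cell itself loses through
each of its two faces at most the combination of its own values. The CFL ratios
compare, node by node, the coefficient in the average with the total coefficient
in these losses; so [H1] is bounded below by a combination of the nodal values
with strictly positive coefficients. Consequently [H1] is nonnegative, and if it
vanishes then so does [g] on the whole line ([row_positivity]). Exchanging the
roles of x and y gives the same for [H2] ([H1_transpose]).

Gauss weights are positive ([gauss_weight_pos]), so the new average is
nonnegative. If it were zero, [g] would vanish on all horizontal and vertical
lines through the Gauss points. There are at least two horizontal ones and a
vertical one, and a polynomial of total degree 2 vanishing on them is zero
([poly2_vanishing]); then the old average of the cell would be the integral of
[g M] = 0, contradicting its positivity ([cell_avg_eq0]). *)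

(** * Quadratics and polynomials of total degree two *)

Definition is_quadratic (f : R -> R) : Prop :=
  exists u v w, forall x, f x = u + v * x + w * x ^ 2.

Lemma poly2_coeffs (f : R -> R -> R) : is_poly2 2 f ->
  exists a b c d e h, forall x y,
    f x y = a + b * y + c * y ^ 2 + d * x + e * x * y + h * x ^ 2.
Proof.
intros [a E].
exists (a 0 0)%nat, (a 0 1)%nat, (a 0 2)%nat, (a 1 0)%nat, (a 1 1)%nat, (a 2 0)%nat.
intros x y; rewrite E.
rewrite !sum_Sn, !sum_O; cbn [Nat.sub]; rewrite !sum_Sn, !sum_O.
unfold plus; cbn; ring.
Qed.

Lemma poly2_row (f : R -> R -> R) (y : R) : is_poly2 2 f -> is_quadratic (fun x => f x y).
Proof.
intros Hf; destruct (poly2_coeffs f Hf) as (a & b & c & d & e & h & E).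
exists (a + b * y + c * y ^ 2), (d + e * y), h; intros x; rewrite E; ring.
Qed.

Lemma is_poly2_swap (f : R -> R -> R) : is_poly2 2 f -> is_poly2 2 (fun x y => f y x).
Proof.
intros Hf; destruct (poly2_coeffs f Hf) as (a & b & c & d & e & h & E).
exists (fun p r => match p, r with
  | O, O => a | 1%nat, O => b | 2%nat, O => c
  | O, 1%nat => d | 1%nat, 1%nat => e | O, 2%nat => h
  | _, _ => 0 end).
intros x y; rewrite E.
rewrite !sum_Sn, !sum_O; cbn [Nat.sub]; rewrite !sum_Sn, !sum_O.
unfold plus; cbn; ring.
Qed.

Lemma quadratic_eq0 (u v w : R) :
  (forall x, u + v * x + w * x ^ 2 = 0) -> u = 0 /\ v = 0 /\ w = 0.
Proof.
intros E; pose proof (E 0); pose proof (E 1); pose proof (E (-1)); lra.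
Qed.

(** Vanishing on two horizontal lines leaves only a multiple of
(y - y1) (y - y2), which the vertical line then kills. *)
Lemma poly2_vanishing (f : R -> R -> R) (x1 y1 y2 : R) : is_poly2 2 f -> y1 <> y2 ->
  (forall x, f x y1 = 0) -> (forall x, f x y2 = 0) -> (forall y, f x1 y = 0) ->
  forall x y, f x y = 0.
Proof.
intros Hf Hy E1 E2 E3 x y.
destruct (poly2_coeffs f Hf) as (a & b & c & d & e & h & E).
destruct (quadratic_eq0 (a + b * y1 + c * y1 ^ 2) (d + e * y1) h) as (_ & D1 & h0).
{ intros t; rewrite <- (E1 t), E; ring. }
destruct (quadratic_eq0 (a + b * y2 + c * y2 ^ 2) (d + e * y2) h) as (_ & D2 & _).
{ intros t; rewrite <- (E2 t), E; ring. }
assert (e0 : e = 0).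
{ apply (Rmult_eq_reg_r (y1 - y2)); [lra|]; intros ?; apply Hy; lra. }
assert (d0 : d = 0) by (rewrite e0 in D1; lra).
rewrite <- (E3 y), !E, e0, d0, h0; ring.
Qed.

(** * Positivity of Gauss weights *)

Lemma sum_1_S (f : nat -> R) (n : nat) : sum_n_m f 1 (S n) = sum_n_m f 1 n + f (S n).
Proof. exact (sum_n_Sm f 1 n ltac:(lia)). Qed.

Lemma sum_1_0 (f : nat -> R) : sum_n_m f 1 0 = 0.
Proof. exact (sum_n_m_zero f 1 0 ltac:(lia)). Qed.

Lemma sum_term_le (f : nat -> R) (n i : nat) :
  (forall i, (1 <= i <= n)%nat -> 0 <= f i) -> (1 <= i <= n)%nat ->
  f i <= sum_n_m f 1 n.
Proof.
assert (N : forall n, (forall i, (1 <= i <= n)%nat -> 0 <= f i) -> 0 <= sum_n_m f 1 n).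
{ clear n i; induction n as [|n IH]; intros H; [rewrite sum_1_0; lra|].
  rewrite sum_1_S; apply Rplus_le_le_0_compat; [|apply H; lia].
  apply IH; intros; apply H; lia. }
induction n as [|n IH]; intros H Hi; [lia|].
rewrite sum_1_S; destruct (Nat.eq_dec i (S n)) as [->|].
- assert (0 <= sum_n_m f 1 n) by (apply N; intros; apply H; lia); lra.
- assert (f i <= sum_n_m f 1 n) by (apply IH; [intros; apply H|]; lia).
  assert (0 <= f (S n)) by (apply H; lia); lra.
Qed.

Lemma sum_single (f : nat -> R) (n i : nat) : (1 <= i <= n)%nat ->
  (forall i', (1 <= i' <= n)%nat -> i' <> i -> f i' = 0) -> f i = sum_n_m f 1 n.
Proof.
assert (N : forall n, (forall i, (1 <= i <= n)%nat -> f i = 0) -> 0 = sum_n_m f 1 n).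
{ clear n i; induction n as [|n IH]; intros H; [now rewrite sum_1_0|].
  rewrite sum_1_S, <- IH, H by (intros; try apply H; lia); ring. }
induction n as [|n IH]; intros Hi H; [lia|].
rewrite sum_1_S; destruct (Nat.eq_dec i (S n)) as [->|].
- rewrite <- N by (intros; apply H; lia); ring.
- rewrite <- IH by (intros; try apply H; lia); rewrite (H (S n)) by lia; ring.
Qed.

Definition poly_deg (d : nat) (f : R -> R) : Prop :=
  exists a : nat -> R, forall t, f t = sum_n (fun p => a p * t ^ p) d.

Lemma poly_deg_le d d' f : (d <= d')%nat -> poly_deg d f -> poly_deg d' f.
Proof.
intros Hd; induction Hd as [|d' _ IH]; [easy|].
intros Hf; destruct (IH Hf) as [a E].
exists (fun p => if (p <=? d')%nat then a p else 0); intros t.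
rewrite sum_Sn, E, (proj2 (Nat.leb_gt (S d') d')) by lia.
rewrite (sum_n_ext_loc (fun p => a p * t ^ p)
  (fun p => (if (p <=? d')%nat then a p else 0) * t ^ p)).
- unfold plus; cbn; ring.
- now intros p Hp; rewrite (proj2 (Nat.leb_le p d')).
Qed.

Lemma poly_deg_mul_X d f : poly_deg d f -> poly_deg (S d) (fun t => t * f t).
Proof.
intros [a E]; exists (fun p => match p with O => 0 | S p => a p end); intros t.
rewrite E; clear E; induction d as [|d IH].
- rewrite sum_Sn, !sum_O; unfold plus; cbn; ring.
- rewrite sum_Sn, (sum_Sn _ (S d)), <- IH; unfold plus; cbn; ring.
Qed.

Lemma poly_deg_lin d f h r : poly_deg d f -> poly_deg d h ->
  poly_deg d (fun t => f t + r * h t).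
Proof.
intros [a E] [b F]; exists (fun p => a p + r * b p); intros t.
rewrite E, F; clear E F; induction d as [|d IH].
- rewrite !sum_O; ring.
- rewrite !sum_Sn, <- IH; unfold plus; cbn; ring.
Qed.

Lemma poly_deg_ext d f h : (forall t, f t = h t) -> poly_deg d f -> poly_deg d h.
Proof. intros E [a F]; exists a; intros t; now rewrite <- E. Qed.

Lemma poly_deg_mul_root d f r : poly_deg d f -> poly_deg (S d) (fun t => (t - r) * f t).
Proof.
intros Hf; apply poly_deg_ext with (fun t => t * f t + - r * f t); [intros; ring|].
apply poly_deg_lin; [now apply poly_deg_mul_X|].
now apply (poly_deg_le d); [lia|].
Qed.

(** Squares are written as two linear factors so that the degree can be counted
one factor at a time. *)
Definition sq_prod (nodes : list R) (t : R) : R :=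
  fold_right (fun r v => (t - r) * ((t - r) * v)) 1 nodes.

Lemma sq_prod_deg nodes : poly_deg (2 * length nodes) (sq_prod nodes).
Proof.
induction nodes as [|r nodes IH].
- exists (fun _ => 1); intros t; rewrite sum_O; cbn; ring.
- replace (2 * length (r :: nodes))%nat with (S (S (2 * length nodes))) by (cbn; lia).
  apply (poly_deg_mul_root _ (fun t => (t - r) * sq_prod nodes t) r).
  now apply poly_deg_mul_root.
Qed.

Lemma sq_prod_nonneg nodes t : 0 <= sq_prod nodes t.
Proof.
induction nodes as [|r nodes IH]; cbn; [lra|].
rewrite <- Rmult_assoc; apply Rmult_le_pos; [apply Rle_0_sqr|easy].
Qed.

Lemma sq_prod_eq0 nodes t : In t nodes -> sq_prod nodes t = 0.
Proof.
induction nodes as [|r nodes IH]; cbn; [easy|intros [->|H]]; [ring|].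
change ((t - r) * ((t - r) * sq_prod nodes t) = 0); rewrite (IH H); ring.
Qed.

Lemma sq_prod_neq0 nodes t : ~ In t nodes -> sq_prod nodes t <> 0.
Proof.
induction nodes as [|r nodes IH]; cbn; intros H; [lra|].
assert (t - r <> 0) by (intros ?; apply H; left; lra).
repeat apply Rmult_integral_contrapositive_currified; trivial.
apply IH; tauto.
Qed.

(** Strict positivity of the integrand is only required at one point, possibly an
end of the interval, since a product of squares vanishes at its nodes. *)
Lemma RInt_pos_at (f : R -> R) (a b c : R) : a < b -> a <= c <= b ->
  (forall x, continuous f x) -> (forall x, 0 <= f x) -> 0 < f c -> 0 < RInt f a b.
Proof.
intros ab ac C N fc.
assert (I : forall u v, ex_RInt f u v) by (intros; now apply @ex_RInt_continuous).
destruct (C c (fun z => 0 < z)) as [d Hd].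
{ exists (mkposreal _ fc); intros z Hz; apply Rabs_lt_between' in Hz; cbn in Hz; lra. }
pose proof (cond_pos d) as d0.
set (u := Rmax a (c - d / 2)); set (v := Rmin b (c + d / 2)).
assert (U : a <= u /\ c - d / 2 <= u) by (split; [apply Rmax_l|apply Rmax_r]).
assert (V : v <= b /\ v <= c + d / 2) by (split; [apply Rmin_l|apply Rmin_r]).
assert (uv : u < v).
{ unfold u, v; apply Rmax_case; apply Rmin_case; lra. }
assert (P : 0 < RInt f u v).
{ apply RInt_gt_0; trivial.
  intros x Hx; apply Hd, Rabs_lt_between'; lra. }
assert (G : forall p q, p <= q -> 0 <= RInt f p q) by (intros; now apply RInt_ge_0).
assert (E1 : RInt f a u + RInt f u b = RInt f a b) by exact (RInt_Chasles f a u b (I _ _) (I _ _)).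
assert (E2 : RInt f u v + RInt f v b = RInt f u b) by exact (RInt_Chasles f u v b (I _ _) (I _ _)).
pose proof (G a u ltac:(lra)); pose proof (G v b ltac:(lra)); lra.
Qed.

(** Testing the rule on the squared product over all other nodes, of degree 2n - 2,
isolates the i-th weight: it is a positive integral divided by a positive value. *)
Lemma gauss_weight_pos (n : nat) (s w : nat -> R) : gauss_rule n s w ->
  forall i, (1 <= i <= n)%nat -> 0 < w i.
Proof.
intros (Hs & Inc & Exact) i Hi.
set (nodes := map s (seq 1 (i - 1) ++ seq (S i) (n - i))).
assert (Nodes : forall i', (1 <= i' <= n)%nat -> i' <> i -> In (s i') nodes).
{ intros i' ? ?; apply in_map, in_app_iff; rewrite !in_seq; lia. }
assert (Off : ~ In (s i) nodes).
{ unfold nodes; rewrite in_map_iff; intros (i' & E & I).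
  rewrite in_app_iff, !in_seq in I.
  destruct (Nat.lt_total i i') as [H|[H|H]]; [|lia|].
  - assert (s i < s i') by (apply Inc; lia); lra.
  - assert (s i' < s i) by (apply Inc; lia); lra. }
assert (Deg : poly_deg (2 * n - 1) (sq_prod nodes)).
{ apply (poly_deg_le (2 * length nodes)); [|apply sq_prod_deg].
  unfold nodes; rewrite length_map, length_app, !length_seq; lia. }
destruct Deg as [a E].
pose proof (Exact a) as X.
rewrite <- (sum_single _ n i) in X; trivial.
2:{ intros i' ? ?; rewrite <- E, sq_prod_eq0 by auto; ring. }
rewrite <- E in X.
assert (I : 0 < RInt (fun t => sum_n (fun p => a p * t ^ p) (2 * n - 1)) (-1) 1).
{ rewrite (RInt_ext _ (sq_prod nodes)) by (intros; symmetry; apply E).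
  assert (C : forall t, continuous (sq_prod nodes) t).
  { intros t; apply (ex_derive_continuous (V := R_NormedModule)).
    clear; induction nodes as [|r l IH]; [apply ex_derive_const|].
    apply (ex_derive_mult (fun t => t - r) (fun t => (t - r) * sq_prod l t));
      [auto_derive; auto|].
    apply (ex_derive_mult (fun t => t - r) (sq_prod l)); [auto_derive; auto|easy]. }
  apply RInt_pos_at with (s i); trivial; [lra|now apply Hs|apply sq_prod_nonneg|].
  destruct (sq_prod_nonneg nodes (s i)) as [?|E0]; [easy|].
  now destruct (sq_prod_neq0 _ _ Off). }
pose proof (sq_prod_nonneg nodes (s i)).
destruct (Rlt_or_le 0 (w i)) as [|N]; [easy|].
assert (w i * sq_prod nodes (s i) <= 0) by nra; lra.
Qed.

(** * Nodal form of the numerical flux *)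

Lemma mesh_dx_pos (T : mesh) : 0 < dx T.
Proof.
apply Rdiv_lt_0_compat; [apply Lx_pos|]; apply lt_0_INR; pose proof (P_pos T); lia.
Qed.

Lemma xpt_right (T : mesh) (j : nat) : (1 <= j)%nat -> xpt T j 1 = xh T j.
Proof. intros Hj; unfold xpt, xh; rewrite minus_INR by lia; cbn; field. Qed.

Lemma xpt_left (T : mesh) (j : nat) : (1 <= j)%nat -> xpt T j (-1) = xh T (j - 1).
Proof. intros Hj; unfold xpt, xh; rewrite minus_INR by lia; cbn; field. Qed.

Lemma quadratic_derivatives (f : R -> R) (u v w : R) :
  (forall x, f x = u + v * x + w * x ^ 2) ->
  forall x, Derive f x = v + 2 * w * x /\ Derive_n f 2 x = 2 * w.
Proof.
intros E.
assert (D : forall x, Derive f x = v + 2 * w * x).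
{ intros x; rewrite (Derive_ext _ _ _ E).
  apply is_derive_unique; auto_derive; [auto|ring]. }
intros x; split; [apply D|].
change (Derive (Derive f) x = 2 * w); rewrite (Derive_ext _ _ _ D).
apply is_derive_unique; auto_derive; [auto|ring].
Qed.

Lemma quadratic_three_roots (f : R -> R) (c h gam : R) : is_quadratic f -> 0 < h ->
  -1 < gam < 1 -> f (c + h / 2 * -1) = 0 -> f (c + h / 2 * gam) = 0 ->
  f (c + h / 2 * 1) = 0 -> forall x, f x = 0.
Proof.
intros (u & v & w & E) Hh Hg Z1 Z2 Z3 x; rewrite E in *.
assert (Y1 : h * (v + 2 * w * c) = 0) by lra.
apply Rmult_integral in Y1; destruct Y1 as [|Y1]; [lra|].
assert (Y2 : (1 - gam ^ 2) * (w * (h * h)) = 0).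
{ replace ((1 - gam ^ 2) * (w * (h * h))) with
    (4 * (u + v * (c + h / 2 * 1) + w * (c + h / 2 * 1) ^ 2)
     - 4 * (u + v * (c + h / 2 * gam) + w * (c + h / 2 * gam) ^ 2)
     - 2 * h * (1 - gam) * (v + 2 * w * c)) by field.
  rewrite Z2, Z3, Y1; ring. }
apply Rmult_integral in Y2; destruct Y2 as [|Y2]; [nra|].
apply Rmult_integral in Y2; destruct Y2 as [w0|]; [|nra].
subst w; assert (v = 0) by lra; subst v; lra.
Qed.

(** The share of one cell in the numerical flux through one of its faces, up to the
mesh size and the sign: [near] is the value at that face, [far] at the opposite
face and [mid] at the interior node. *)
Definition trace_flux (b0 b1 gam far mid near : R) : R :=
  alpha1 b1 gam * far + 2 * (1 - 4 * b1) / (1 - gam ^ 2) * mid + alpha3 b0 b1 gam * near.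

(** For e = 1 the face is the right one, the jump takes the value of the cell with a
minus sign and the share is subtracted from the flux; for e = -1 it is the left
one and the share is added. The
first derivative changes sign relative to the other two terms because it enters
the flux through a mean instead of a jump. *)
Lemma trace_flux_eq (f : R -> R) (c h gam e b0 b1 : R) : is_quadratic f -> 0 < h ->
  -1 < gam < 1 -> e = 1 \/ e = -1 ->
  let x := c + h / 2 * e in
  b0 / h * f x - e / 2 * Derive f x + b1 * h * Derive_n f 2 x
  = / h * trace_flux b0 b1 (e * gam) (f (c + h / 2 * - e)) (f (c + h / 2 * gam)) (f x).
Proof.
intros (u & v & w & E) Hh Hg He x.
destruct (quadratic_derivatives f u v w E x) as [-> ->].
unfold trace_flux, alpha1, alpha3, x; rewrite !E.
destruct He as [-> | ->]; field; repeat split; nra.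
Qed.

Lemma alpha1_nonneg (b1 gam : R) : -1 < gam < 1 -> Rabs gam <= 8 * b1 - 1 ->
  0 <= alpha1 b1 gam.
Proof.
intros Hg Hb; apply Rabs_le_between in Hb.
apply Rmult_le_pos; [lra|]; apply Rlt_le, Rinv_0_lt_compat; lra.
Qed.

(** The bound on |gamma| makes the fraction in [alpha3] at least -1, which
[b0 >= 1] compensates. *)
Lemma alpha3_nonneg (b0 b1 gam : R) : 1 <= b0 -> -1 < gam < 1 ->
  Rabs gam <= 8 * b1 - 1 -> 0 <= alpha3 b0 b1 gam.
Proof.
intros H0 Hg Hb; apply Rabs_le_between in Hb; unfold alpha3.
replace (b0 + (8 * b1 - 3 + gam) / (2 * (1 - gam)))
  with (b0 - 1 + (8 * b1 - 1 - gam) / (2 * (1 - gam))) by (field; lra).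
apply Rplus_le_le_0_compat; [lra|].
apply Rmult_le_pos; [lra|]; apply Rlt_le, Rinv_0_lt_compat; lra.
Qed.

Lemma trace_flux_nonneg (b0 b1 gam far mid near : R) : 1 <= b0 -> b1 <= 1 / 4 ->
  -1 < gam < 1 -> Rabs gam <= 8 * b1 - 1 -> 0 <= far -> 0 <= mid -> 0 <= near ->
  0 <= trace_flux b0 b1 gam far mid near.
Proof.
intros H0 H1 Hg Hb Hf Hm Hn; unfold trace_flux.
repeat apply Rplus_le_le_0_compat; apply Rmult_le_pos; trivial.
- now apply alpha1_nonneg.
- apply Rmult_le_pos; [lra|]; apply Rlt_le, Rinv_0_lt_compat; nra.
- now apply alpha3_nonneg.
Qed.

(** * The CFL ratios *)

(** If the denominator vanishes the ratio is infinite and gives no bound, but then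
the conclusion is just the positivity of the numerator. *)
Lemma quot_lt (x n d : R) : 0 < n -> 0 <= d -> Rbar_lt x (quot n d) -> x * d < n.
Proof.
intros Hn Hd; unfold quot; destruct (Req_dec_T d 0) as [->|Hd0]; cbn; intros H; [lra|].
apply (Rmult_lt_compat_r d) in H; [|lra].
now replace (n / d * d) with n in H by now field.
Qed.

Lemma Rbar_lt_min (x a b : Rbar) : Rbar_lt x (Rbar_min a b) -> Rbar_lt x a /\ Rbar_lt x b.
Proof.
intros H; split; eapply Rbar_lt_le_trans; try exact H; [apply Rbar_min_l|apply Rbar_min_r].
Qed.

Lemma Rbar_lt_min_over (x : Rbar) (n : nat) (f : nat -> Rbar) :
  Rbar_lt x (Rbar_min_over n f) -> forall i, (1 <= i <= n)%nat -> Rbar_lt x (f i).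
Proof.
intros H i Hi; assert (I : In i (seq 1 n)) by (apply in_seq; lia); clear Hi.
unfold Rbar_min_over in H; induction (seq 1 n) as [|k l IH]; [easy|].
apply Rbar_lt_min in H; destruct H, I as [<-|]; auto.
Qed.

Lemma Rbar_lt_min_over3 (x : Rbar) (n p r : nat) (f : nat -> nat -> nat -> Rbar) :
  Rbar_lt x (Rbar_min_over n (fun j => Rbar_min_over p (fun l => Rbar_min_over r (f j l)))) ->
  forall j l i, (1 <= j <= n)%nat -> (1 <= l <= p)%nat -> (1 <= i <= r)%nat ->
  Rbar_lt x (f j l i).
Proof.
intros H j l i Hj Hl Hi.
apply (Rbar_lt_min_over _ r (f j l)); [|easy].
apply (Rbar_lt_min_over _ p (fun l => Rbar_min_over r (f j l))); [|easy].
now apply (Rbar_lt_min_over _ n (fun j => Rbar_min_over p (fun l => Rbar_min_over r (f j l)))).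
Qed.

(** * Positivity along a line *)

Section Row.
(* Everything below lives on the line at height [y] through the cells (1,l), ...,
   (P,l); [gam j] is the interior node of the cell (j,l). *)
Context (T : mesh) (b0 b1 dt : R) (M g : pw) (l : nat) (y : R) (gam : nat -> R).
Context (M_pos : forall j, (1 <= j <= P T)%nat -> forall x, 0 < M j l x y).
Context (M_cont : forall j, (1 <= j <= P T)%nat ->
  forall x, continuous (fun t => M j l t y) x).
Context (g_quad : forall j, (1 <= j <= P T)%nat -> is_quadratic (fun x => g j l x y)).
Context (gam_choice : forall j, (1 <= j <= P T)%nat ->
  a_x T M j l y < gam j < b_x T M j l y /\ Rabs (gam j) <= 8 * b1 - 1).
Context (g_nonneg : forall j, (1 <= j <= P T)%nat ->
  forall t, In t (-1 :: gam j :: 1 :: nil) -> 0 <= g j l (xpt T j t) y).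
Context (b0_large : 1 <= b0) (b1_small : b1 <= 1 / 4).
Context (mu_nonneg : 0 <= mu T dt).

Definition moment (j p : nat) : R := wavg_x T M (fun t => t ^ p) j l y.

Lemma weight_continuous j : (1 <= j <= P T)%nat ->
  forall t, continuous (fun t => M j l (xpt T j t) y) t.
Proof.
intros Hj t; apply (continuous_comp (xpt T j) (fun x => M j l x y)); [|now apply M_cont].
apply (ex_derive_continuous (V := R_NormedModule)); unfold xpt; auto_derive; auto.
Qed.

Lemma poly_weight_continuous j (phi : R -> R) : (1 <= j <= P T)%nat -> is_quadratic phi ->
  forall t, continuous (fun t => phi t * M j l (xpt T j t) y) t.
Proof.
intros Hj (u & v & w & E) t.
apply (continuous_mult phi); [|now apply weight_continuous].
apply (continuous_ext (fun x => u + v * x + w * x ^ 2)); [intros; now rewrite E|].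
apply (ex_derive_continuous (V := R_NormedModule)); auto_derive; auto.
Qed.

Lemma wavg_moments j (phi : R -> R) (u v w : R) : (1 <= j <= P T)%nat ->
  (forall t, phi t = u + v * t + w * t ^ 2) ->
  wavg_x T M phi j l y = u * moment j 0 + v * moment j 1 + w * moment j 2.
Proof.
intros Hj E; unfold moment, wavg_x.
assert (X : forall p, (p <= 2)%nat ->
  ex_RInt (fun t => t ^ p * M j l (xpt T j t) y) (-1) 1).
{ intros p Hp; apply @ex_RInt_continuous; intros t _.
  apply (poly_weight_continuous j (fun t => t ^ p)); trivial.
  destruct p as [|[|[|]]]; [exists 1, 0, 0|exists 0, 1, 0|exists 0, 0, 1|lia]; intros; ring. }
rewrite (RInt_ext _ (fun t => 1 * (u * (t ^ 0 * M j l (xpt T j t) y)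
    + v * (t ^ 1 * M j l (xpt T j t) y)) + w * (t ^ 2 * M j l (xpt T j t) y)))
  by (intros; rewrite E; cbn; ring).
rewrite RInt_lin_R; [|clear X|exact (X 2%nat (le_n _))].
- rewrite RInt_lin_R; [ring|exact (X 0%nat ltac:(lia))|exact (X 1%nat ltac:(lia))].
- apply @ex_RInt_continuous; intros t _.
  apply (continuous_ext (fun t => (u + v * t) * M j l (xpt T j t) y)); [intros; cbn; ring|].
  apply (poly_weight_continuous j (fun t => u + v * t)); trivial.
  exists u, v, 0; intros; ring.
Qed.

Lemma wavg_pos j (phi : R -> R) : (1 <= j <= P T)%nat -> is_quadratic phi ->
  (forall t, -1 < t < 1 -> 0 < phi t) -> 0 < wavg_x T M phi j l y.
Proof.
intros Hj Hq Hp; apply Rmult_lt_0_compat; [lra|].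
apply RInt_gt_0; [lra| |].
- intros t Ht; apply Rmult_lt_0_compat; auto.
- intros t _; now apply poly_weight_continuous.
Qed.

Lemma moments_pos j : (1 <= j <= P T)%nat ->
  0 < moment j 0 - moment j 1 /\ 0 < moment j 0 + moment j 1 /\
  0 < moment j 0 - moment j 2.
Proof.
intros Hj; repeat split.
- replace (moment j 0 - moment j 1) with (wavg_x T M (fun t => 1 - t) j l y).
  + apply wavg_pos; trivial; [exists 1, (-1), 0; intros; ring|intros; lra].
  + rewrite (wavg_moments j _ 1 (-1) 0) by (trivial; intros; ring); ring.
- replace (moment j 0 + moment j 1) with (wavg_x T M (fun t => 1 + t) j l y).
  + apply wavg_pos; trivial; [exists 1, 1, 0; intros; ring|intros; lra].
  + rewrite (wavg_moments j _ 1 1 0) by (trivial; intros; ring); ring.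
- replace (moment j 0 - moment j 2) with (wavg_x T M (fun t => 1 - t ^ 2) j l y).
  + apply wavg_pos; trivial; [exists 1, 0, (-1); intros; ring|intros; nra].
  + rewrite (wavg_moments j _ 1 0 (-1)) by (trivial; intros; ring); ring.
Qed.

(** The numerators of the endpoint ratios: for e = 1 and e = -1 the polynomials are
(t - gamma) (t - 1) and (t - gamma) (t + 1), the unnormalized Lagrange polynomials
of the nodes -1 and 1. *)
Definition endpoint_moment (j : nat) (e : R) : R :=
  wavg_x T M (fun t => e * gam j - e * t * (1 + e * gam j) + t ^ 2) j l y.

Lemma endpoint_moment_eq j e : (1 <= j <= P T)%nat ->
  endpoint_moment j e
  = e * gam j * moment j 0 - e * (1 + e * gam j) * moment j 1 + moment j 2.
Proof.
intros Hj; unfold endpoint_moment.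
rewrite (wavg_moments j _ (e * gam j) (- (e * (1 + e * gam j))) 1) by (trivial; intros; ring).
ring.
Qed.

(** a and b are averages of the reference variable over (-1,1), with weights
(1 - t) M and (1 + t) M, so gamma lies in the open interval; and the two
inequalities a < gamma < b, cleared of denominators, are the positivity of the
endpoint moments. *)
Lemma gam_interior j : (1 <= j <= P T)%nat ->
  -1 < gam j < 1 /\ 0 < endpoint_moment j 1 /\ 0 < endpoint_moment j (-1).
Proof.
intros Hj; destruct (moments_pos j Hj) as (m01 & m10 & m02).
destruct (gam_choice j Hj) as [[Ha Hb] _]; rewrite !endpoint_moment_eq by easy.
unfold a_x, b_x in Ha, Hb.
rewrite (wavg_moments j _ 0 1 (-1)), (wavg_moments j _ 1 (-1) 0) in Ha by (trivial; intros; ring).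
rewrite (wavg_moments j _ 0 1 1), (wavg_moments j _ 1 1 0) in Hb by (trivial; intros; ring).
apply (Rmult_lt_compat_r _ _ _ m01) in Ha; apply (Rmult_lt_compat_r _ _ _ m10) in Hb.
unfold Rdiv in Ha, Hb; rewrite Rmult_assoc in Ha, Hb.
replace (1 * moment j 0 + -1 * moment j 1 + 0 * moment j 2)
  with (moment j 0 - moment j 1) in Ha by ring.
replace (1 * moment j 0 + 1 * moment j 1 + 0 * moment j 2)
  with (moment j 0 + moment j 1) in Hb by ring.
rewrite Rinv_l, Rmult_1_r in Ha, Hb by lra.
repeat split; nra.
Qed.

(** Lagrange interpolation of [g] at -1, gamma and 1, integrated against [M]. *)
Lemma row_average j : (1 <= j <= P T)%nat ->
  / dx T * int_x T j (fun x => g j l x y * M j l x y)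
  = endpoint_moment j 1 / (2 * (1 + gam j)) * g j l (xpt T j (-1)) y
    + wavg_x T M (fun t => 1 - t ^ 2) j l y / (1 - gam j ^ 2) * g j l (xpt T j (gam j)) y
    + endpoint_moment j (-1) / (2 * (1 - gam j)) * g j l (xpt T j 1) y.
Proof.
intros Hj; destruct (gam_interior j Hj) as [Hg _].
pose proof (mesh_dx_pos T) as Hdx.
destruct (g_quad j Hj) as (u & v & w & E).
set (c := (xh T (j - 1) + xh T j) / 2); set (h := dx T / 2).
assert (Xp : forall t, xpt T j t = h * t + c) by (intros; unfold xpt, h, c; ring).
replace (/ dx T * int_x T j (fun x => g j l x y * M j l x y))
  with (wavg_x T M (fun t => g j l (xpt T j t) y) j l y).
2:{ unfold int_x, wavg_x; rewrite <- xpt_left, <- xpt_right by lia; rewrite !Xp.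
  rewrite <- (RInt_comp_lin (fun x => g j l x y * M j l x y)).
  - rewrite (RInt_ext (fun z => scal h (g j l (h * z + c) y * M j l (h * z + c) y))
      (fun t => h * (g j l (xpt T j t) y * M j l (xpt T j t) y)  + 0 * 0))
      by (intros; rewrite Xp; unfold scal; cbn; unfold mult; cbn; ring).
    rewrite RInt_lin_R; [unfold h; field; lra| |apply ex_RInt_const].
    apply @ex_RInt_continuous; intros t _.
    apply (poly_weight_continuous j (fun t => g j l (xpt T j t) y)); trivial.
    exists (u + v * c + w * c ^ 2), (h * v + 2 * w * h * c), (w * h ^ 2).
    intros; rewrite E, Xp; ring.
  - apply @ex_RInt_continuous; intros x _.
    apply (continuous_mult (fun x => g j l x y)); [|now apply M_cont].
    apply (continuous_ext (fun x => u + v * x + w * x ^ 2)); [intros; now rewrite E|].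
    apply (ex_derive_continuous (V := R_NormedModule)); auto_derive; auto. }
rewrite (wavg_moments j _ (u + v * c + w * c ^ 2) (h * v + 2 * w * h * c) (w * h ^ 2))
  by (trivial; intros; rewrite E, Xp; ring).
rewrite !endpoint_moment_eq, (wavg_moments j _ 1 0 (-1)) by (trivial; intros; ring).
rewrite !E, !Xp; field; repeat split; nra.
Qed.

Lemma avg_x_pos i : (i <= P T)%nat -> 0 < avg_x T M i l y.
Proof.
intros Hi; pose proof (P_pos T); unfold avg_x, mean_x.
destruct (Nat.eqb_spec i 0); [apply M_pos; lia|].
destruct (Nat.eqb_spec i (P T)); [apply M_pos; lia|].
apply Rmult_lt_0_compat; [lra|]; apply Rplus_lt_0_compat; apply M_pos; lia.
Qed.

(** What the cell j loses at most through its right and its left face. For the left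
face the cell is reflected, which exchanges the end values and negates gamma. *)
Definition out_right (j : nat) : R := trace_flux b0 b1 (gam j)
  (g j l (xpt T j (-1)) y) (g j l (xpt T j (gam j)) y) (g j l (xpt T j 1) y).
Definition out_left (j : nat) : R := trace_flux b0 b1 (- gam j)
  (g j l (xpt T j 1) y) (g j l (xpt T j (gam j)) y) (g j l (xpt T j (-1)) y).

Lemma out_nonneg j : (1 <= j <= P T)%nat -> 0 <= out_right j /\ 0 <= out_left j.
Proof.
intros Hj; destruct (gam_interior j Hj) as [Hg _]; destruct (gam_choice j Hj) as [_ Hb].
pose proof (g_nonneg j Hj) as N.
split; apply trace_flux_nonneg; rewrite ?Rabs_Ropp; trivial; try lra;
  apply N; cbn; tauto.
Qed.

Lemma interior_flux i : (1 <= i < P T)%nat ->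
  dx T * ddg_x T b0 b1 g i l y = out_left (S i) - out_right i.
Proof.
intros Hi; pose proof (mesh_dx_pos T) as Hdx.
assert (Hi1 : (1 <= i <= P T)%nat) by lia.
assert (Hi2 : (1 <= S i <= P T)%nat) by lia.
pose proof (trace_flux_eq _ ((xh T (i - 1) + xh T i) / 2) _ _ 1 b0 b1 (g_quad i Hi1) Hdx
  (proj1 (gam_interior i Hi1)) (or_introl eq_refl)) as R1.
pose proof (trace_flux_eq _ ((xh T (S i - 1) + xh T (S i)) / 2) _ _ (-1) b0 b1 (g_quad (S i) Hi2) Hdx
  (proj1 (gam_interior (S i) Hi2)) (or_intror eq_refl)) as R2.
cbv zeta in R1, R2.
change ((xh T (i - 1) + xh T i) / 2 + dx T / 2 * ?t) with (xpt T i t) in R1.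
change ((xh T (S i - 1) + xh T (S i)) / 2 + dx T / 2 * ?t) with (xpt T (S i) t) in R2.
replace (1 * gam i) with (gam i) in R1 by ring.
replace (-1 * gam (S i)) with (- gam (S i)) in R2 by ring.
replace (- (1)) with (-1) in R1 by ring; replace (- -1) with 1 in R2 by ring.
apply (f_equal (Rmult (dx T))) in R1, R2.
rewrite <- Rmult_assoc, Rinv_r, Rmult_1_l in R1, R2 by lra.
fold (out_right i) in R1; fold (out_left (S i)) in R2.
rewrite <- R1, <- R2, xpt_right, xpt_left by lia.
replace (S i - 1)%nat with i by lia.
unfold ddg_x, jump_x, mean_x, Defs.Dx, Dxx; field; lra.
Qed.

(** The other cell at the interface can only increase the gain of the cell j; at the
boundary of the domain the flux is zero. *)
Lemma flux_bounds j : (1 <= j <= P T)%nat ->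
  - out_right j <= dx T * flux_x T b0 b1 g j l y /\
  dx T * flux_x T b0 b1 g (j - 1) l y <= out_left j.
Proof.
intros Hj; destruct (out_nonneg j Hj) as [N1 N2]; unfold flux_x; split.
- destruct (Nat.eqb_spec j 0); [lia|].
  destruct (Nat.eqb_spec j (P T)); cbn [orb]; [lra|].
  rewrite interior_flux by lia.
  destruct (out_nonneg (S j)); [lia|lra].
- destruct (Nat.eqb_spec (j - 1) 0); cbn [orb]; [lra|].
  destruct (Nat.eqb_spec (j - 1) (P T)); [lia|].
  rewrite interior_flux by lia; replace (S (j - 1)) with j by lia.
  destruct (out_nonneg (j - 1)); [lia|lra].
Qed.

(** The coefficients [cA], [cG], [cB] of the lower bound are those of the average
minus those of the losses; the three CFL ratios say exactly that they are
positive. *)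
Lemma row_positivity j : (1 <= j <= P T)%nat ->
  Rbar_lt (mu T dt) (cfl_ratio (fun phi => wavg_x T M phi j l y) b0 b1 (gam j)
    (avg_x T M (j - 1) l y) (avg_x T M j l y)) ->
  0 <= H1 T b0 b1 dt M g j l y /\
  (H1 T b0 b1 dt M g j l y = 0 -> forall x, g j l x y = 0).
Proof.
intros Hj C; apply Rbar_lt_min in C; destruct C as [C CM].
apply Rbar_lt_min in C; destruct C as [CA CB].
unfold H1; rewrite row_average by easy.
pose proof (avg_x_pos (j - 1) ltac:(lia)) as ML.
pose proof (avg_x_pos j ltac:(lia)) as MR.
set (ml := avg_x T M (j - 1) l y) in *; set (mr := avg_x T M j l y) in *.
destruct (flux_bounds j Hj) as [FR FL].
destruct (gam_interior j Hj) as (Hg & NA & NB).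
destruct (gam_choice j Hj) as [_ Hb].
pose proof (g_nonneg j Hj) as N.
assert (A0 : 0 <= g j l (xpt T j (-1)) y) by (apply N; cbn; tauto).
assert (G0 : 0 <= g j l (xpt T j (gam j)) y) by (apply N; cbn; tauto).
assert (B0 : 0 <= g j l (xpt T j 1) y) by (apply N; cbn; tauto).
assert (NM : 0 < wavg_x T M (fun t => 1 - t ^ 2) j l y).
{ apply wavg_pos; trivial; [exists 1, 0, (-1); intros; ring|intros; nra]. }
pose proof (alpha1_nonneg b1 (gam j) Hg Hb).
pose proof (alpha3_nonneg b0 b1 (gam j) b0_large Hg Hb).
pose proof (alpha1_nonneg b1 (- gam j) ltac:(lra) ltac:(now rewrite Rabs_Ropp)).
pose proof (alpha3_nonneg b0 b1 (- gam j) b0_large ltac:(lra) ltac:(now rewrite Rabs_Ropp)).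
unfold endpoint_ratio in CA, CB; unfold middle_ratio in CM.
fold (endpoint_moment j 1) in CA; fold (endpoint_moment j (-1)) in CB.
replace (1 * gam j) with (gam j) in CA by ring.
replace (-1 * gam j) with (- gam j) in CB by ring; rewrite Ropp_involutive in CB.
apply quot_lt in CA, CB, CM; trivial; try (repeat apply Rmult_le_pos; nra).
unfold out_right, out_left, trace_flux in FR, FL.
replace ((- gam j) ^ 2) with (gam j ^ 2) in FL by ring.
set (A := g j l (xpt T j (-1)) y) in *; set (G := g j l (xpt T j (gam j)) y) in *.
set (B := g j l (xpt T j 1) y) in *.
set (cA := (endpoint_moment j 1 - mu T dt * (2 * (1 + gam j)
  * (alpha3 b0 b1 (- gam j) * ml + alpha1 b1 (gam j) * mr))) / (2 * (1 + gam j))).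
set (cG := (wavg_x T M (fun t => 1 - t ^ 2) j l y
  - mu T dt * (2 * (1 - 4 * b1) * (ml + mr))) / (1 - gam j ^ 2)).
set (cB := (endpoint_moment j (-1) - mu T dt * (2 * (1 - gam j)
  * (alpha3 b0 b1 (gam j) * mr + alpha1 b1 (- gam j) * ml))) / (2 * (1 - gam j))).
assert (cA0 : 0 < cA) by (apply Rdiv_lt_0_compat; lra).
assert (cG0 : 0 < cG) by (apply Rdiv_lt_0_compat; nra).
assert (cB0 : 0 < cB).
{ apply Rdiv_lt_0_compat; [|lra]; replace (1 - gam j) with (1 + - gam j) by ring; lra. }
match goal with |- 0 <= ?h /\ _ => assert (Bound : cA * A + cG * G + cB * B <= h) end.
{ apply (Rmult_le_compat_l mr) in FR; [|lra]; apply (Rmult_le_compat_l ml) in FL; [|lra].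
  (* The slack of the two flux bounds, weighted by M on the interfaces and by mu. *)
  assert (D : 0 <= mu T dt * (mr * (dx T * flux_x T b0 b1 g j l y)
     + mr * (alpha1 b1 (gam j) * A + 2 * (1 - 4 * b1) / (1 - gam j ^ 2) * G
             + alpha3 b0 b1 (gam j) * B)
     + ml * (alpha1 b1 (- gam j) * B + 2 * (1 - 4 * b1) / (1 - gam j ^ 2) * G
             + alpha3 b0 b1 (- gam j) * A)
     - ml * (dx T * flux_x T b0 b1 g (j - 1) l y))).
  { apply Rmult_le_pos; lra. }
  apply Rminus_le_0; refine (Rle_trans _ _ _ D (Req_le _ _ _)).
  unfold cA, cG, cB; field; repeat split; nra. }
pose proof (Rmult_le_pos cA A (Rlt_le _ _ cA0) A0).
pose proof (Rmult_le_pos cG G (Rlt_le _ _ cG0) G0).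
pose proof (Rmult_le_pos cB B (Rlt_le _ _ cB0) B0).
split; [lra|intros Z].
(* A vanishing sum of nonnegative terms forces the three nodal values to vanish. *)
assert (Zero : forall a b, 0 < a -> a * b = 0 -> b = 0).
{ intros a b Ha E; apply Rmult_integral in E; lra. }
apply (quadratic_three_roots _ ((xh T (j - 1) + xh T j) / 2) (dx T) (gam j)); auto using mesh_dx_pos.
- change (A = 0); apply (Zero cA); trivial; lra.
- change (G = 0); apply (Zero cG); trivial; lra.
- change (B = 0); apply (Zero cB); trivial; lra.
Qed.

End Row.

(** * Both directions *)

Definition transpose (T : mesh) : mesh :=
  Mesh (Ly T) (Lx T) (Q T) (P T) (Ly_pos T) (Lx_pos T) (Q_pos T) (P_pos T).
Definition swap (w : pw) : pw := fun j l x y => w l j y x.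

Lemma mu_transpose (T : mesh) (dt : R) : mu (transpose T) dt = mu T dt.
Proof. apply Rplus_comm. Qed.

(** The definitions for the y direction are those for the x direction on the
transposed mesh, up to conversion; only the sum in [mu] has to be commuted. *)
Lemma H1_transpose (T : mesh) (b0 b1 dt : R) (M g : pw) (j l : nat) (x : R) :
  H1 (transpose T) b0 b1 dt (swap M) (swap g) l j x = H2 T b0 b1 dt M g j l x.
Proof. unfold H1; rewrite mu_transpose; reflexivity. Qed.

Lemma weightM_cont (T : mesh) (qi : R) (psi : pw) (j l : nat) (y : R) :
  in_Vh T 2 psi -> is_cell T j l ->
  forall x, continuous (fun t => weightM qi psi j l t y) x.
Proof.
intros V C x; apply (sm_continuous (weightM qi psi j l)), sm_exp, sm_mul;
  [apply sm_cst|apply (sm_poly 2), V, C].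
Qed.

(** The CFL condition is required line by line and not through [mu0_x], because on
the transposed mesh the minima over the rows and the columns of cells are taken
in the other order. *)
Lemma lines_positivity (T : mesh) (n : nat) (s : nat -> R) (b0 b1 dt qi : R) (psi g : pw)
    (gx : nat -> nat -> nat -> R) (M := weightM qi psi) :
  b1 <= 1 / 4 -> 1 <= b0 -> 0 <= mu T dt -> in_Vh T 2 psi -> in_Vh T 2 g ->
  gamma_choice_x T n s b1 M gx ->
  (forall j l i t, is_cell T j l -> (1 <= i <= n)%nat ->
     In t (-1 :: gx j l i :: 1 :: nil) -> 0 <= g j l (xpt T j t) (ypt T l (s i))) ->
  (forall j l i, is_cell T j l -> (1 <= i <= n)%nat -> let y := ypt T l (s i) in
     Rbar_lt (mu T dt) (cfl_ratio (fun phi => wavg_x T M phi j l y) b0 b1 (gx j l i)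
       (avg_x T M (j - 1) l y) (avg_x T M j l y))) ->
  forall j l i, is_cell T j l -> (1 <= i <= n)%nat ->
  0 <= H1 T b0 b1 dt M g j l (ypt T l (s i)) /\
  (H1 T b0 b1 dt M g j l (ypt T l (s i)) = 0 -> forall x, g j l x (ypt T l (s i)) = 0).
Proof.
intros Hb1 Hb0 Hmu psi_Vh g_Vh choice N cfl j l i [Hj Hl] Hi.
assert (C : forall j', (1 <= j' <= P T)%nat -> is_cell T j' l) by (split; trivial).
apply row_positivity with (gam := fun j' => gx j' l i); trivial.
- intros; apply exp_pos.
- intros; apply (weightM_cont T); auto.
- intros j' Hj'; apply poly2_row, g_Vh, C, Hj'.
- intros; apply choice; auto.
- intros; apply N; auto.
- now apply cfl.
Qed.

(** * Positivity of the cell averages *)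

(** The projection that defines [g], tested with 1, gives [c] and [g M] the same
integral over each cell. *)
Lemma cell_avg_eq0 (T : mesh) (k : nat) (M c g : pw) (j l : nat) :
  is_projection T k M c g -> is_cell T j l -> (forall x y, g j l x y = 0) ->
  cell_avg T c j l = 0.
Proof.
intros [_ Pr] C Z.
pose proof (Pr _ (in_Vh_one T k) j l C) as E; cbv beta in E.
rewrite (int_cell_ext T j l (fun x y => c j l x y * 1) (c j l)) in E by (intros; ring).
assert (Z0 : forall a b, RInt (fun _ => 0) a b = 0).
{ intros a b; rewrite RInt_const; apply Rmult_0_r. }
assert (Zx : forall y, int_x T j (fun x => g j l x y * M j l x y * 1) = 0).
{ intros y; rewrite <- (Z0 (xh T (j - 1)) (xh T j)); apply RInt_ext; intros x _.
  rewrite Z, !Rmult_0_l; reflexivity. }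
unfold cell_avg; rewrite <- E; unfold int_cell, int_y.
rewrite (RInt_ext _ (fun _ => 0)) by (intros y _; apply Zx).
rewrite Z0; apply Rmult_0_r.
Qed.

Lemma mesh_dy_pos (T : mesh) : 0 < dy T.
Proof. exact (mesh_dx_pos (transpose T)). Qed.

Theorem theorem4p1
  (T : mesh) (k : nat) (k_eq : k = 2%nat)
  (L : nat) (s w : nat -> R)
  (L_large : (k + 2 <= 2 * L)%nat) (gauss : gauss_rule L s w)
  (beta0 beta1 dt : R)
  (beta1_range : 1 / 8 <= beta1 <= 1 / 4) (beta0_large : 1 <= beta0)
  (dt_pos : 0 < dt)
  (m : nat) (q : nat -> R) (D : poisson_data)
  (c : nat -> pw) (c_Vh : forall i, (1 <= i <= m)%nat -> in_Vh T k (c i))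
  (psi : pw) (psi_Vh : in_Vh T k psi) (psi_eq : ddg_poisson T k D m q c psi)
  (i : nat) (i_species : (1 <= i <= m)%nat)
  (M : pw) (M_def : M = weightM (q i) psi)
  (g : pw) (g_def : is_projection T k M (c i) g)
  (gx gy : nat -> nat -> nat -> R)
  (gx_choice : gamma_choice_x T L s beta1 M gx)
  (gy_choice : gamma_choice_y T L s beta1 M gy)
  (g_nonneg : forall j l, is_cell T j l -> forall x y,
     in_test_set T L s gx gy j l x y -> 0 <= g j l x y)
  (avg_pos : forall j l, is_cell T j l -> 0 < cell_avg T (c i) j l)
  (cfl : Rbar_lt (mu T dt) (mu0 T L s beta0 beta1 M gx gy))
  (c' : pw) (c'_Vh : in_Vh T k c')
  (c'_avg : forall j l, is_cell T j l ->
     cell_avg T c' j l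
     = average_update T (gauss_x T L s w) (gauss_y T L s w) beta0 beta1 dt M g j l) :
  forall j l, is_cell T j l -> 0 < cell_avg T c' j l.
Proof.
subst k M; intros j l C.
pose proof (proj1 g_def) as g_Vh.
assert (Mx : 0 < mu_x T dt).
{ apply Rdiv_lt_0_compat; [easy|apply pow_lt, mesh_dx_pos]. }
assert (My : 0 < mu_y T dt).
{ apply Rdiv_lt_0_compat; [easy|apply pow_lt, mesh_dy_pos]. }
assert (Mu : 0 < mu T dt) by (unfold mu; lra).
apply Rbar_lt_min in cfl; destruct cfl as [cflx cfly].
assert (Hx : forall i', (1 <= i' <= L)%nat ->
  0 <= H1 T beta0 beta1 dt (weightM (q i) psi) g j l (ypt T l (s i')) /\
  (H1 T beta0 beta1 dt (weightM (q i) psi) g j l (ypt T l (s i')) = 0 ->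
   forall x, g j l x (ypt T l (s i')) = 0)).
{ intros i' Hi'; apply lines_positivity with L gx; trivial; try lra.
  - intros j0 l0 i0 t C0 Hi0 Ht; apply g_nonneg; trivial.
    exists i0; split; [easy|right; split; [easy|now exists t]].
  - intros j0 l0 i0 [Hj0 Hl0] Hi0; exact (Rbar_lt_min_over3 _ _ _ _ _ cflx _ _ _ Hj0 Hl0 Hi0). }
assert (Hy : forall i', (1 <= i' <= L)%nat ->
  0 <= H2 T beta0 beta1 dt (weightM (q i) psi) g j l (xpt T j (s i')) /\
  (H2 T beta0 beta1 dt (weightM (q i) psi) g j l (xpt T j (s i')) = 0 ->
   forall y, g j l (xpt T j (s i')) y = 0)).
{ intros i' Hi'; rewrite <- H1_transpose.
  assert (TC : forall j' l', is_cell (transpose T) l' j' -> is_cell T j' l').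
  { intros j' l' [? ?]; now split. }
  apply (lines_positivity (transpose T) L s beta0 beta1 dt (q i) (swap psi) (swap g)
    (fun l j => gy j l)); rewrite ?mu_transpose; trivial; try lra.
  - intros l' j' C'; apply is_poly2_swap, psi_Vh, TC, C'.
  - intros l' j' C'; apply is_poly2_swap, g_Vh, TC, C'.
  - intros l' j' i0 C'; apply gy_choice, TC, C'.
  - intros l0 j0 i0 t C0 Hi0 Ht; apply g_nonneg; [now apply TC|].
    exists i0; split; [easy|left; split; [easy|now exists t]].
  - intros l0 j0 i0 [Hl0 Hj0] Hi0; exact (Rbar_lt_min_over3 _ _ _ _ _ cfly _ _ _ Hj0 Hl0 Hi0).
  - destruct C; now split. }
pose proof (gauss_weight_pos L s w gauss) as W.
assert (Px : forall i', (1 <= i' <= L)%nat ->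
  0 <= w i' * H1 T beta0 beta1 dt (weightM (q i) psi) g j l (ypt T l (s i'))).
{ intros i' Hi'; apply Rmult_le_pos; [apply Rlt_le, W, Hi'|apply Hx, Hi']. }
assert (Py : forall i', (1 <= i' <= L)%nat ->
  0 <= w i' * H2 T beta0 beta1 dt (weightM (q i) psi) g j l (xpt T j (s i'))).
{ intros i' Hi'; apply Rmult_le_pos; [apply Rlt_le, W, Hi'|apply Hy, Hi']. }
assert (Sx : forall i', (1 <= i' <= L)%nat ->
  w i' * H1 T beta0 beta1 dt (weightM (q i) psi) g j l (ypt T l (s i'))
  <= gauss_y T L s w l (H1 T beta0 beta1 dt (weightM (q i) psi) g j l)).
{ intros i' Hi'; exact (sum_term_le _ L i' Px Hi'). }
assert (Sy : forall i', (1 <= i' <= L)%nat ->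
  w i' * H2 T beta0 beta1 dt (weightM (q i) psi) g j l (xpt T j (s i'))
  <= gauss_x T L s w j (H2 T beta0 beta1 dt (weightM (q i) psi) g j l)).
{ intros i' Hi'; exact (sum_term_le _ L i' Py Hi'). }
rewrite c'_avg by easy; unfold average_update.
set (SX := gauss_y T L s w l _) in *; set (SY := gauss_x T L s w j _) in *.
assert (One : (1 <= 1 <= L)%nat) by lia.
assert (Two : (1 <= 2 <= L)%nat) by lia.
pose proof (Rle_trans _ _ _ (Px _ One) (Sx _ One)) as SX0.
pose proof (Rle_trans _ _ _ (Py _ One) (Sy _ One)) as SY0.
assert (Rx : 0 < mu_x T dt / mu T dt) by now apply Rdiv_lt_0_compat.
assert (Ry : 0 < mu_y T dt / mu T dt) by now apply Rdiv_lt_0_compat.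
assert (Pos : 0 < SX \/ 0 < SY).
{ destruct SX0 as [|SX0]; [now left|]; destruct SY0 as [|SY0]; [now right|exfalso].
  assert (Zero : forall a b, 0 < a -> 0 <= b -> a * b <= 0 -> b = 0) by (intros; nra).
  assert (Zx : forall i', (1 <= i' <= L)%nat -> forall x, g j l x (ypt T l (s i')) = 0).
  { intros i' Hi'; apply Hx; trivial; apply (Zero (w i')); [now apply W|now apply Hx|].
    rewrite SX0; now apply Sx. }
  assert (Zy : forall i', (1 <= i' <= L)%nat -> forall y, g j l (xpt T j (s i')) y = 0).
  { intros i' Hi'; apply Hy; trivial; apply (Zero (w i')); [now apply W|now apply Hy|].
    rewrite SY0; now apply Sy. }
  pose proof (avg_pos j l C) as Av.
  rewrite (cell_avg_eq0 T 2 (weightM (q i) psi) (c i) g j l g_def C) in Av; [lra|].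
  apply (poly2_vanishing _ (xpt T j (s 1%nat)) (ypt T l (s 1%nat)) (ypt T l (s 2%nat)));
    auto.
  intros Eq; destruct gauss as (_ & Inc & _).
  pose proof (Inc 1%nat 2%nat ltac:(lia) ltac:(lia) ltac:(lia)) as Lt12.
  pose proof (mesh_dy_pos T); unfold ypt in Eq; nra. }
pose proof (Rmult_le_pos _ _ (Rlt_le _ _ Rx) SX0).
pose proof (Rmult_le_pos _ _ (Rlt_le _ _ Ry) SY0).
destruct Pos as [X|X].
- pose proof (Rmult_lt_0_compat _ _ Rx X); lra.
- pose proof (Rmult_lt_0_compat _ _ Ry X); lra.
Qed.
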